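(* For any labelled multiset $A$ of positive integers, \[ \widetilde F_A\in\sum_{\alpha\vDash S_A}\mathbb{N}[q]\,C_\alpha(1), \] where the sum ranges over all compositions $\alpha$ of $S_A$; that is, there exist coefficients $b_\alpha\in\mathbb{N}[q]$ with $\widetilde F_A=\sum_{\alpha\vDash S_A}b_\alpha\,C_\alpha(1)$.
   Context: $\Lambda$ is the ring of symmetric functions in $X=x_1+x_2+\cdots$ over $\mathbb{Q}(q,t)$; $m_\mu,h_r,p_k$ are monomial, complete homogeneous and power-sum symmetric functions. $\mathbb{N}[q]$ is the set of polynomials with nonnegative integer coefficients. Operators $C_a$ ($a\ge1$): $C_a$ is the linear operator on $\Lambda$ given by $C_a(f)[X]=\left(-\tfrac1q\right)^{a-1}\langle z^a\rangle\, f\!\left[X-\tfrac{1-1/q}{z}\right]\sum_{r\ge0}h_r[X]z^r$, where $\langle z^a\rangle$ takes the coefficient of $z^a$ and the plethystic evaluation replaces each $p_k$ in $f$ by $p_k[X]-(1-q^{-k})z^{-k}$. A composition of $n$ is a sequence $\alpha=(\alpha_1,\ldots,\alpha_m)$ of positive integers with sum $n$, written $\alpha\vDash n$ (the empty sequence being the unique composition of $0$), and $C_\alpha(f)=C_{\alpha_1}(C_{\alpha_2}(\cdots C_{\alpha_m}(f)\cdots))$, with $C_\emptyset(f)=f$. A labelled multiset $A$ is a finite multiset of positive integers in which copies of equal values are distinguished by labels, so it is treated as a finite set; in formulas an element stands for its integer value. $S_A=\sum_{x\in A}x$ (with $S_\emptyset=0$), and $\ell(A)$ is the number of elements. $\mu(A)$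 is the partition whose parts are the values of the elements of $A$, and $m_i(A)$ is the multiplicity of $i$. Define $F_A=(-1)^{S_A-\ell(A)}m_{\mu(A)}$ and $\widetilde F_A=\bigl(\prod_{i\ge1}m_i(A)!\bigr)F_A$, with $\widetilde F_\emptyset=1$. *)

(* Defs.v *)
From HB Require Import structures.
From mathcomp Require Import all_boot all_order all_algebra all_fingroup.
From mathcomp Require Import boolp.
From mathcomp Require Import mpoly.

Set Implicit Arguments.
Unset Strict Implicit.
Unset Printing Implicit Defensive.

Import GRing.Theory.
Local Open Scope ring_scope.

(** * The ring of symmetric functions *)

(** A symmetric function is represented by its restrictions
    [f(x_1, ..., x_n)] to finitely many variables: the ring is the subalgebra
    [symfun] of the algebra of all families [forall n, {mpoly F[n]}] made of the
    symmetric, compatible families of bounded degree (the inverse limit of the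
    rings of symmetric polynomials in the category of graded rings). *)

Section SymmetricFunctions.
Variable F : fieldType.

Definition mpoly_family : Type := forall n, {mpoly F[n]}.

HB.instance Definition _ := gen_eqMixin mpoly_family.
HB.instance Definition _ := gen_choiceMixin mpoly_family.

Definition family0 : mpoly_family := fun n => 0.
Definition family1 : mpoly_family := fun n => 1.
Definition family_opp (f : mpoly_family) : mpoly_family := fun n => - f n.
Definition family_add (f g : mpoly_family) : mpoly_family :=
  fun n => f n + g n.
Definition family_mul (f g : mpoly_family) : mpoly_family :=
  fun n => f n * g n.
Definition family_scale (c : F) (f : mpoly_family) : mpoly_family :=
  fun n => c *: f n.

Fact mpoly_familyP (f g : mpoly_family) : (forall n, f n = g n) -> f = g.
Proof. exact: functional_extensionality_dep. Qed.

Fact family_addA : associative family_add.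
Proof. by move=> f g h; apply: mpoly_familyP => n; apply: addrA. Qed.
Fact family_addC : commutative family_add.
Proof. by move=> f g; apply: mpoly_familyP => n; apply: addrC. Qed.
Fact family_add0 : left_id family0 family_add.
Proof. by move=> f; apply: mpoly_familyP => n; apply: add0r. Qed.
Fact family_addN : left_inverse family0 family_opp family_add.
Proof. by move=> f; apply: mpoly_familyP => n; apply: addNr. Qed.

HB.instance Definition _ := GRing.isZmodule.Build mpoly_family
  family_addA family_addC family_add0 family_addN.

Fact family_mulA : associative family_mul.
Proof. by move=> f g h; apply: mpoly_familyP => n; apply: mulrA. Qed.
Fact family_mulC : commutative family_mul.
Proof. by move=> f g; apply: mpoly_familyP => n; apply: mulrC. Qed.
Fact family_mul1 : left_id family1 family_mul.
Proof. by move=> f; apply: mpoly_familyP => n; apply: mul1r. Qed.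
Fact family_mulDl : left_distributive family_mul family_add.
Proof. by move=> f g h; apply: mpoly_familyP => n; apply: mulrDl. Qed.
Fact family1_neq0 : family1 != 0.
Proof.
apply/eqP => /(congr1 (fun f : mpoly_family => f 0%N)) /eqP.
by rewrite oner_eq0.
Qed.

HB.instance Definition _ := GRing.Zmodule_isComNzRing.Build mpoly_family
  family_mulA family_mulC family_mul1 family_mulDl family1_neq0.

Fact family_scaleA a b f :
  family_scale a (family_scale b f) = family_scale (a * b) f.
Proof. by apply: mpoly_familyP => n; apply: scalerA. Qed.
Fact family_scale1 : left_id 1 family_scale.
Proof. by move=> f; apply: mpoly_familyP => n; apply: scale1r. Qed.
Fact family_scaleDr : right_distributive family_scale +%R.
Proof. by move=> a f g; apply: mpoly_familyP => n; apply: scalerDr. Qed.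
Fact family_scaleDl f : {morph family_scale^~ f : a b / a + b}.
Proof. by move=> a b; apply: mpoly_familyP => n; apply: scalerDl. Qed.

HB.instance Definition _ := GRing.Zmodule_isLmodule.Build F mpoly_family
  family_scaleA family_scale1 family_scaleDr family_scaleDl.

Fact family_scaleAl (a : F) (f g : mpoly_family) : a *: (f * g) = a *: f * g.
Proof. by apply: mpoly_familyP => n; apply: scalerAl. Qed.

HB.instance Definition _ :=
  GRing.Lmodule_isLalgebra.Build F mpoly_family family_scaleAl.
HB.instance Definition _ :=
  GRing.Lalgebra_isComAlgebra.Build F mpoly_family.

(** [f(x_1, ..., x_n, x_{n+1})] at [x_{n+1} = 0] *)
Definition vars_rcons0 n : n.+1.-tuple {mpoly F[n]} :=
  [tuple of rcons [tuple 'X_i | i < n] 0].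

Definition restrict n (f : {mpoly F[n.+1]}) : {mpoly F[n]} :=
  f \mPo vars_rcons0 n.

Fact vars_rcons0_widen n (i : 'I_n) :
  tnth (vars_rcons0 n) (widen_ord (leqnSn n) i) = 'X_i.
Proof.
rewrite (tnth_nth 0) /= nth_rcons size_map size_enum_ord ltn_ord.
by rewrite (nth_map i) ?size_enum_ord // nth_ord_enum.
Qed.

Fact vars_rcons0_max n : tnth (vars_rcons0 n) ord_max = 0.
Proof. by rewrite (tnth_nth 0) /= nth_rcons size_map size_enum_ord ltnn eqxx. Qed.

Definition is_symfun (f : mpoly_family) : Prop :=
  [/\ forall n, f n \is symmetric,
      forall n, restrict (f n.+1) = f n
    & exists d, forall n, (msize (f n) <= d)%N].

Definition symfun_pred : {pred mpoly_family} := fun f => `[< is_symfun f >].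

Fact symfun_subalg_closed : subalg_closed symfun_pred.
Proof.
split.
- apply/asboolP; split=> [n|n|]; first exact: rpred1.
  + exact: comp_mpoly1.
  + by exists 1%N => n; rewrite msize1.
- move=> a f g /asboolP[fs fr [df fd]] /asboolP[gs gr [dg gd]].
  apply/asboolP; split=> [n|n|].
  + by apply: rpredD; [apply: rpredZ; apply: fs|apply: gs].
  + rewrite /restrict comp_mpolyD comp_mpolyZ.
    by congr (_ *: _ + _); [apply: fr|apply: gr].
  + exists (maxn df dg) => n; apply: leq_trans (msizeD_le _ _) _.
    rewrite geq_max !leq_max gd orbT andbT.
    by rewrite (leq_trans (msizeZ_le _ _) (fd n)).
- move=> f g /asboolP[fs fr [df fd]] /asboolP[gs gr [dg gd]].
  apply/asboolP; split=> [n|n|].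
  + by apply: rpredM; [apply: fs|apply: gs].
  + by rewrite /restrict rmorphM; congr (_ * _); [apply: fr|apply: gr].
  + exists (df + dg).+1 => n; apply: leq_trans (msizeM_le _ _) _.
    by rewrite ltnS leq_add.
Qed.

HB.instance Definition _ := GRing.isSubalgClosed.Build F mpoly_family
  symfun_pred symfun_subalg_closed.

Record symfun : Type := Symfun {
  symfun_family :> mpoly_family;
  symfun_subproof : symfun_family \in symfun_pred
}.

HB.instance Definition _ := [isSub for symfun_family].
HB.instance Definition _ := [Choice of symfun by <:].
HB.instance Definition _ := [SubChoice_isSubComNzRing of symfun by <:].
HB.instance Definition _ := [SubZmodule_isSubLmodule of symfun by <:].
HB.instance Definition _ := [SubNzRing_SubLmodule_isSubLalgebra of symfun by <:].
HB.instance Definition _ := [SubLalgebra_isSubAlgebra of symfun by <:].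

(** The multiset of the nonzero exponents of a monomial. *)
Definition exponents n (m : 'X_{1..n}) : seq nat :=
  [seq e <- [seq m i | i <- enum 'I_n] | e != 0%N].

Fact mdeg_exponents n (m : 'X_{1..n}) : mdeg m = sumn (exponents m).
Proof.
rewrite mdegE sumnE big_filter big_map [RHS]big_mkcond /= big_enum /=.
by apply: eq_bigr => i _; case: eqP.
Qed.

Fact exponents_mperm n (m : 'X_{1..n}) (s : 'S_n) :
  perm_eq (exponents [multinom m (s i) | i < n]) (exponents m).
Proof.
apply: perm_filter.
have -> : [seq [multinom m (s i) | i < n] i | i <- enum 'I_n] = [seq m i | i <- map s (enum 'I_n)].
  by rewrite -[RHS]map_comp; apply/eq_in_map => i _ /=; rewrite mnmE.
apply: perm_map; apply: uniq_perm; rewrite ?enum_uniq //.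
  by rewrite map_inj_uniq ?enum_uniq //; apply: perm_inj.
move=> i; rewrite mem_enum; apply/mapP; exists (s^-1%g i).
  by rewrite mem_enum.
by rewrite permKV.
Qed.

Definition mnm_rcons0 n (m : 'X_{1..n}) : 'X_{1..n.+1} :=
  [multinom nth 0%N (rcons m 0%N) i | i < n.+1].

Fact exponents_rcons0 n (m : 'X_{1..n}) : exponents (mnm_rcons0 m) = exponents m.
Proof.
rewrite /exponents enum_ordSr map_rcons filter_rcons.
rewrite mnmE nth_rcons size_tuple ltnn eqxx /=; congr filter.
rewrite -map_comp; apply/eq_in_map => i _ /=.
by rewrite mnmE nth_rcons size_tuple /= (ltn_ord (i : 'I_n)) (mnm_nth 0%N).
Qed.

Fact mcoeff_restrict n (f : {mpoly F[n.+1]}) m :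
  (restrict f)@_m = f@_(mnm_rcons0 m).
Proof.
rewrite /restrict comp_mpolyE raddf_sum /= [f in RHS]mpolyE raddf_sum /=.
apply: eq_bigr => e _; rewrite !mcoeffZ mcoeffX; congr (_ * _).
rewrite big_ord_recr /= vars_rcons0_max.
under eq_bigr => i _ do rewrite vars_rcons0_widen.
pose e' := [multinom e (widen_ord (leqnSn n) i) | i < n].
have -> : \prod_(i < n) 'X_i ^+ e (widen_ord (leqnSn n) i) = 'X_[e'] :> {mpoly F[n]}.
  by rewrite [RHS]mpolyXE_id; apply: eq_bigr => i _; rewrite mnmE.
have -> : (e == mnm_rcons0 m) = (e' == m) && (e ord_max == 0%N).
  apply/eqP/andP => [em|[/eqP em /eqP e0]].
    split; last by rewrite em mnmE nth_rcons size_tuple ltnn eqxx.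
    apply/eqP/mnmP => i; rewrite mnmE em mnmE nth_rcons size_tuple /= ltn_ord.
    by rewrite -mnm_nth.
  apply/mnmP => i; rewrite mnmE nth_rcons size_tuple.
  have [lt_in|le_ni] := ltnP i n.
    have -> : i = widen_ord (leqnSn n) (Ordinal lt_in) by apply: val_inj.
    by rewrite /= -(mnm_nth 0%N m (Ordinal lt_in)) -em mnmE.
  have eq_in : i = n :> nat by apply/eqP; rewrite eqn_leq le_ni -ltnS ltn_ord.
  by rewrite eq_in eqxx -e0; congr (e _); apply: val_inj.
rewrite expr0n; case: eqP => _; rewrite ?mulr1 ?mulr0 ?andbT ?andbF ?mcoeff0 //.
by rewrite mcoeffX.
Qed.

Fact symfun_of_mcoeff (f : mpoly_family) (P : seq nat -> bool) d :
    (forall n (m : 'X_{1..n}), (f n)@_m = (P (exponents m))%:R) ->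
    (forall s t, perm_eq s t -> P s = P t) ->
    (forall s, P s -> (sumn s <= d)%N) ->
  f \in symfun_pred.
Proof.
move=> fE Pperm Pd; apply/asboolP; split=> [n|n|].
- apply/issymP => s; apply/mpolyP => m; rewrite mcoeff_sym !fE.
  by congr (_%:R); congr nat_of_bool; apply: Pperm; apply: exponents_mperm.
- by apply/mpolyP => m; rewrite mcoeff_restrict !fE exponents_rcons0.
- exists d.+1 => n; rewrite msizeE big_seq; apply/bigmax_leqP_seq => m.
  move=> _; rewrite mcoeff_msupp fE ltnS mdeg_exponents => Pm.
  by apply: Pd; case: (P _) Pm => //; rewrite eqxx.
Qed.

(** The power sum [p_(k+1)] (there is no [p_0] in infinitely many variables). *)
Definition psum_family k : mpoly_family := fun n => \sum_(i < n) 'X_i ^+ k.+1.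

(** The complete homogeneous function [h_r]: all monomials of degree [r]. *)
Definition hsum_family r : mpoly_family :=
  fun n => \sum_(m : 'X_{1..n < r.+1} | mdeg m == r) 'X_[m].

(** The monomial function [m_mu]: the monomials whose nonzero exponents are the
    parts of [mu]. *)
Definition msum_family (mu : seq nat) : mpoly_family :=
  fun n => \sum_(m : 'X_{1..n < (sumn mu).+1} | perm_eq (exponents m) mu) 'X_[m].

Fact mcoeff_sumX n d (P : pred 'X_{1..n}) (m : 'X_{1..n}) :
    (forall e : 'X_{1..n}, P e -> (mdeg e < d)%N) ->
  (\sum_(e : 'X_{1..n < d} | P e) 'X_[e] : {mpoly F[n]})@_m = (P m)%:R.
Proof.
move=> Pd; rewrite raddf_sum /=.
under eq_bigr => e _ do rewrite mcoeffX.
case Pm: (P m).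
  rewrite (bigD1 (BMultinom (Pd _ Pm))) //= eqxx big1 ?addr0 // => e.
  by case/andP=> _; rewrite -val_eqE /= => /negbTE ->.
by rewrite big1 // => e Pe; case: eqP => // eqm; rewrite -eqm Pe in Pm.
Qed.

Fact hsum_subproof r : hsum_family r \in symfun_pred.
Proof.
apply: (@symfun_of_mcoeff _ (fun s => sumn s == r) r) => [n m|s t|s /eqP-> //].
  rewrite /hsum_family (mcoeff_sumX (P := fun e => mdeg e == r)) ?mdeg_exponents //.
  by move=> e; rewrite ltnS => /eqP->.
by move=> /perm_sumn ->.
Qed.

Fact msum_subproof mu : msum_family mu \in symfun_pred.
Proof.
apply: (@symfun_of_mcoeff _ (fun s => perm_eq s mu) (sumn mu)) => [n m|s t|s].
- rewrite /msum_family (mcoeff_sumX (P := fun e => perm_eq (exponents e) mu)) //.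
  move=> e /perm_sumn.
  by rewrite -mdeg_exponents ltnS => ->.
- by move=> /permPl ->.
- by move=> /perm_sumn ->.
Qed.

Fact psum_subproof k : psum_family k \in symfun_pred.
Proof.
apply/asboolP; split=> [n|n|].
- apply/issymP => s; rewrite /psum_family raddf_sum /=.
  rewrite [RHS](reindex_inj (@perm_inj _ s)); apply: eq_bigr => i _ /=.
  rewrite rmorphXn /=; congr (_ ^+ _); rewrite msymX; congr 'X_[_].
  by apply/mnmP => j; rewrite !mnmE; congr nat_of_bool; rewrite -(inj_eq (@perm_inj _ s)) permKV.
- rewrite /restrict /psum_family raddf_sum /= big_ord_recr /=.
  under eq_bigr => i _ do
    rewrite rmorphXn /= comp_mpolyXU -tnth_nth vars_rcons0_widen.
  rewrite rmorphXn /= comp_mpolyXU -tnth_nth vars_rcons0_max.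
  by rewrite expr0n addr0.
- exists k.+2 => n; rewrite /psum_family.
  apply: leq_trans (msize_sum _ _ _) _; apply/bigmax_leqP => i _.
  by rewrite mpolyXn msizeX mdegMn mdeg1 mul1n.
Qed.

Definition psum k : symfun := Symfun (psum_subproof k).
Definition hsum r : symfun := Symfun (hsum_subproof r).
Definition msum mu : symfun := Symfun (msum_subproof mu).
End SymmetricFunctions.

(** * The operators [C_a] *)

Definition Kqt : fieldType := {fraction {mpoly rat[2]}}.

Definition q : Kqt := tofrac 'X_(0 : 'I_2).
Definition t : Kqt := tofrac 'X_(1 : 'I_2).

Definition Lambda : comAlgType Kqt := symfun Kqt.

Definition eval_q (b : {poly nat}) : Kqt := (map_poly (fun k => k%:R) b).[q].

(** [P(p_1, ..., p_N)], where the variable of index [i] stands for [p_(i+1)] *)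
Definition eval_psum N (P : {mpoly Kqt[N]}) : Lambda :=
  mmap (in_alg Lambda) (fun i : 'I_N => psum Kqt i) P.

(** An expression of [f] as a polynomial in the power sums. It exists for every
    [f], and is unique up to adding unused variables, because the power sums
    generate [Lambda] freely; so what is defined through it below does not depend
    on the choice made here. *)
Definition psum_expansion (f : Lambda) : {N & {mpoly Kqt[N]}} :=
  match pselect (exists e : {N & {mpoly Kqt[N]}}, eval_psum (projT2 e) = f) with
  | left fP => projT1 (cid fP)
  | right _ => existT (fun N => {mpoly Kqt[N]} : Type) 0%N (0 : {mpoly Kqt[0]})
  end.

(** [f[X - (1 - 1/q)/z]], as a polynomial in ['X] = [1/z]. *)
Definition plethysm (f : Lambda) : {poly Lambda} :=
  mmap (fun c => (in_alg Lambda c)%:P)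
    (fun i => (psum Kqt i : Lambda)%:P - in_alg Lambda (1 - q ^- i.+1) *: 'X^(i.+1))
    (projT2 (psum_expansion f)).

(** The coefficient of [z^a] in [(sum_j Q_j z^-j) (sum_r h_r z^r)] is
    [sum_j Q_j h_(a+j)]. *)
Definition C_op (a : nat) (f : Lambda) : Lambda :=
  let Q := plethysm f in
  (- q^-1) ^+ a.-1 *: \sum_(j < size Q) Q`_j * hsum Kqt (a + j).

Definition C_comp (alpha : seq nat) (f : Lambda) : Lambda := foldr C_op f alpha.

(** * Compositions *)

(** A composition of [n+1] is obtained from one of [n] by adding a first part [1]
    or by increasing the first part, if any. *)
Fixpoint compositions (n : nat) : seq (seq nat) :=
  if n is n'.+1 then
    [seq 1%N :: s | s <- compositions n'] ++
    [seq (head 0%N s).+1 :: behead s | s <- compositions n' & s != [::]]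
  else [:: [::]].

Lemma mem_compositions n alpha :
  (alpha \in compositions n) = (0%N \notin alpha) && (sumn alpha == n).
Proof.
elim: n alpha => [|n IHn] [|a s] //=.
- by case: a => [|a]; rewrite !inE /= ?addSn ?andbF.
- by rewrite mem_cat; apply/norP; split; apply/mapP => -[].
rewrite mem_cat in_cons negb_or.
apply/orP/andP => [[/mapP[u]|/mapP[[|b u]]]|[/andP[a0 s0] /eqP sn]].
- by rewrite IHn => /andP[u0 /eqP <-] [-> ->]; rewrite u0 add1n.
- by rewrite mem_filter.
- rewrite mem_filter IHn /= in_cons negb_or => /andP[/andP[_ u0] /eqP <-].
  by case=> -> ->; rewrite u0 addSn.
case: a a0 sn => [|[|a]] // _; rewrite ?add1n ?addSn => -[sn].
  by left; rewrite map_f // IHn s0 sn eqxx.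
right; apply/mapP; exists (a.+1 :: s) => //.
by rewrite mem_filter IHn /= in_cons s0 addSn sn eqxx.
Qed.

Lemma compositions_uniq n : uniq (compositions n).
Proof.
elim: n => //= n IHn; rewrite cat_uniq; apply/and3P; split.
- by rewrite map_inj_uniq // => u v [].
- apply/hasPn => x /mapP[[|b s]]; rewrite mem_filter //= => + ->.
  rewrite mem_compositions in_cons negb_or; case: b => // b _.
  by apply/mapP => -[].
- rewrite map_inj_in_uniq ?filter_uniq // => -[|b u] [|c v].
  all: by rewrite !mem_filter //= => _ _ [-> ->].
Qed.

(** * Labelled multisets *)

Record labelled_multiset := LabelledMultiset {
  label : finType;
  value :> label -> nat;
  value_gt0 : forall x, (0 < value x)%N
}.

Section LabelledMultiset.
Variable A : labelled_multiset.

Definition lm_sum : nat := \sum_(x : label A) A x.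
Definition lm_length : nat := #|label A|.
Definition lm_shape : seq nat := sort geq [seq A x | x <- enum (label A)].
Definition lm_mult (i : nat) : nat := #|[set x | A x == i]|.

Definition F_ : Lambda := (-1) ^+ (lm_sum - lm_length) *: msum Kqt lm_shape.

(** The values are at most [lm_sum], so the product omits only factors [0`!]. *)
Definition Ftilde : Lambda :=
  (\prod_(1 <= i < lm_sum.+1) (lm_mult i)`!)%:R *: F_.

End LabelledMultiset.

(* Main.v *)
Require Import Defs.
From HB Require Import structures.
From mathcomp Require Import all_boot all_algebra.
From mathcomp Require Import boolp mpoly ring zify.
Import GRing.Theory.
Set Implicit Arguments.
Unset Strict Implicit.
Unset Printing Implicit Defensive.
Local Open Scope ring_scope.

(** Write [P_n = (-1)^(n-1) p_n], let [Ft A] be the signed augmented monomial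
    function attached to a list [A] of positive integers, and let [A + n at x]
    be [A] with its entry [x] replaced by [x + n].  Two relations govern
    everything:
    - [P_n * Ft A = Ft (n :: A) - sum_x Ft (A + n at x)]: a power of a variable
      either meets a new variable or merges with one already present
      ([spsum_aug_sym]);
    - [P_n * C_a f = C_a (P_n f) - (q^n - 1) C_(a+n) f]: the plethysm sends [p_n]
      to [p_n - (1 - q^-n) z^-n], and the sign and power of [q] in [C_a] absorb
      the change of index ([Cop_spsum]).

    Together they expand [Ft (r :: A)] into the operators [C]
    ([aug_sym_expansion]): summing over all ways to split [A] into [Y] and [D],
    and with [S = r + sum of Y],

    [[Ft (r :: A) = sum_(Y, D) ( k(r,Y) C_S (Ft D)
                     + sum_(1 <= w < S) kappa(r,Y,w) C_(S-w) (Ft (w :: D)) )]]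

    where [C] consumes the part [r] and the parts [Y] either completely or up to
    a remainder [w], which becomes a new part.  The coefficients are

    [[k(r,Y) = |Y|! sum_(y in r :: Y) [y]_q,
      kappa(r,[],w) = [w < r] q^(r-w-1),
      kappa(r,Y,w) = (|Y|-1)! sum_(y in Y)
        ( [w <= y] q^(r+y-w-1) - [w < r] (q^(r+y-w-1) - q^(r-w-1)) ).]]

    The expansion is proved by induction on the number of parts: writing
    [Ft (r :: n :: A)] through [P_n * Ft (r :: A)], [Ft (r + n :: A)] and the
    [Ft (r :: A + n at x)], the three expansions recombine separately for every
    split [(Y, D)] ([expansion_step]), thanks to recurrences satisfied by [k] and
    [kappa].  The case of a single part is Newton's identity
    [r h_r = sum_k p_k h_(r-k)].

    [kappa] can have a negative coefficient when [y < w < r] for some [y] in [Y].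
    If [r] is the smallest part this cannot happen: then [w < r] forces [w <= y]
    and the bracket collapses to [q^(r-w-1)].  So, choosing [r] minimal, all
    coefficients lie in [N[q]], and since the arguments of [C] have smaller degree
    than [Ft (r :: A)], induction on the degree gives positivity
    ([aug_sym_positive]).

    The plethysm is computed from an arbitrary expression of [f] in the power
    sums; that the result depends on [f] only is a root count.  Substituting [z^-1 := x_i] in
    [f[X - (1 - 1/q)/z]] replaces the variable [x_i] of [f] by [x_i / q].  In [n]
    variables this prescribes the values of a polynomial in [z^-1], of degree
    bounded independently of [n], at [n] distinct points, so it determines the
    polynomial ([is_plethysm_unique]). *)

Local Notation positive A := (forall x : nat, x \in A -> (0 < x)%N).

(** * The plethysm and its values at the variables *)

Section SymfunPlethysm.
Variables (F : fieldType) (q : F).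
Local Notation Lambda := (symfun F).

Definition component n (f : symfun F) : {mpoly F[n]} := symfun_family f n.

Arguments component : simpl never.

Fact component_is_additive n : additive (component n).
Proof. by []. Qed.
Fact component_is_multiplicative n : multiplicative (component n).
Proof. by []. Qed.
HB.instance Definition _ n :=
  GRing.isAdditive.Build Lambda {mpoly F[n]} (component n) (component_is_additive n).
HB.instance Definition _ n :=
  GRing.isMultiplicative.Build Lambda {mpoly F[n]} (component n) (component_is_multiplicative n).

Lemma componentZ n c f : component n (c *: f) = c *: component n f.
Proof. by []. Qed.

Lemma componentD n f g : component n (f + g) = component n f + component n g.
Proof. by []. Qed.

Lemma componentM n f g : component n (f * g) = component n f * component n g.
Proof. by []. Qed.

Lemma mcoeff_component_sum n m (I : Type) (s : seq I) (P : pred I) (f : I -> Lambda) :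
  (component n (\sum_(i <- s | P i) f i))@_m = \sum_(i <- s | P i) (component n (f i))@_m.
Proof. by rewrite raddf_sum raddf_sum. Qed.

Lemma symfun_eq (f g : Lambda) : (forall n, component n f = component n g) -> f = g.
Proof. by move=> fg; apply: val_inj; apply: mpoly_familyP. Qed.

Lemma component_restrict n f : restrict (component n.+1 f) = component n f.
Proof. by case: f => f fP; have /asboolP[_ + _] := fP; apply. Qed.

Lemma component_eq0_leq m n f : (m <= n)%N -> component n f = 0 -> component m f = 0.
Proof.
move=> /subnK <-; elim: (n - m)%N => [|k IHk] //; rewrite addSn => f0.
by apply: IHk; rewrite -component_restrict f0 /restrict comp_mpoly0.
Qed.

Definition shrink_var n (i : 'I_n) : {mpoly F[n]} -> {mpoly F[n]} :=
  comp_mpoly [tuple (if j == i then q^-1 *: 'X_j else 'X_j) | j < n].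

HB.instance Definition _ n (i : 'I_n) := GRing.RMorphism.on (shrink_var i).

Lemma shrink_varXn n (i j : 'I_n) k :
  shrink_var i ('X_j ^+ k) = (if j == i then q^-1 *: 'X_j else 'X_j) ^+ k.
Proof. by rewrite /shrink_var rmorphXn /= comp_mpolyXU -tnth_nth tnth_mktuple. Qed.

Lemma shrink_var_sum n (i : 'I_n) (f : 'I_n -> {mpoly F[n]}) :
  shrink_var i (\sum_j f j) = \sum_j shrink_var i (f j).
Proof. exact: raddf_sum. Qed.

(** The value at [z^-1 = x_i] of [f[X - (1 - 1/q)/z]]: the alphabet
    [X - x_i + x_i/q]. *)
Definition is_plethysm (f : symfun F) (Q : {poly Lambda}) :=
  forall n (i : 'I_n), (map_poly (component n) Q).['X_i] = shrink_var i (component n f).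

(** In [n >= size (Q - Q')] variables the difference has more distinct roots
    than its degree allows, hence vanishes; setting variables to zero gives the
    vanishing in fewer variables. *)
Lemma is_plethysm_unique f Q Q' : is_plethysm f Q -> is_plethysm f Q' -> Q = Q'.
Proof.
move=> fQ fQ'; apply/eqP; rewrite -subr_eq0; apply/eqP; set D := Q - Q'.
suff D0 n : (size D <= n)%N -> map_poly (component n) D = 0.
  apply/polyP => j; rewrite coef0; apply: symfun_eq => n.
  apply: (@component_eq0_leq _ (maxn n (size D))); first exact: leq_maxl.
  by rewrite -coef_map D0 ?coef0 // leq_maxr.
move=> Dn; apply: (@roots_geq_poly_eq0 _ _ [seq 'X_i | i <- enum 'I_n]).
- apply/allP => _ /mapP[i _ ->]; apply/rootP.
  by rewrite rmorphB hornerD hornerN fQ fQ' subrr.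
- rewrite map_inj_uniq ?enum_uniq // => i j /(congr1 (mcoeff U_(i))) /eqP.
  by rewrite !mcoeffX eqxx eq_mnm1; have [->|_] := eqVneq j i; rewrite ?oner_eq0.
- by rewrite size_map size_enum_ord (leq_trans (size_poly _ _)).
Qed.

Lemma is_plethysmD f g P Q : is_plethysm f P -> is_plethysm g Q -> is_plethysm (f + g) (P + Q).
Proof. by move=> fP gQ n i; rewrite !rmorphD hornerD fP gQ. Qed.

Lemma is_plethysmM f g P Q : is_plethysm f P -> is_plethysm g Q -> is_plethysm (f * g) (P * Q).
Proof. by move=> fP gQ n i; rewrite !rmorphM hornerM fP gQ. Qed.

Lemma is_plethysmC c : is_plethysm (in_alg Lambda c) (in_alg Lambda c)%:P.
Proof.
move=> n i; rewrite map_polyC hornerC /GRing.in_alg componentZ rmorph1.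
by rewrite /shrink_var comp_mpolyZ comp_mpoly1.
Qed.

Lemma is_plethysm0 : is_plethysm 0 0.
Proof. by move=> n i; rewrite !rmorph0 horner0. Qed.

Lemma is_plethysm1 : is_plethysm 1 1.
Proof. by move=> n i; rewrite !rmorph1 hornerE. Qed.

Lemma is_plethysmX f Q k : is_plethysm f Q -> is_plethysm (f ^+ k) (Q ^+ k).
Proof.
move=> fQ; elim: k => [|k IHk]; first exact: is_plethysm1.
by rewrite !exprS; apply: is_plethysmM.
Qed.

Lemma is_plethysm_sum (I : Type) (s : seq I) (f : I -> Lambda) (Q : I -> {poly Lambda}) :
  (forall i, is_plethysm (f i) (Q i)) ->
  is_plethysm (\sum_(i <- s) f i) (\sum_(i <- s) Q i).
Proof.
move=> fQ; elim/big_rec2: _ => [|i Q' f' _]; first exact: is_plethysm0.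
exact: is_plethysmD.
Qed.

Lemma is_plethysm_prod (I : Type) (s : seq I) (f : I -> Lambda) (Q : I -> {poly Lambda}) :
  (forall i, is_plethysm (f i) (Q i)) ->
  is_plethysm (\prod_(i <- s) f i) (\prod_(i <- s) Q i).
Proof.
move=> fQ; elim/big_rec2: _ => [|i Q' f' _]; first exact: is_plethysm1.
exact: is_plethysmM.
Qed.

Definition plethysm_psum k : {poly Lambda} :=
  (psum F k : Lambda)%:P - in_alg Lambda (1 - q ^- k.+1) *: 'X^(k.+1).

Lemma is_plethysm_psum k : is_plethysm (psum F k) (plethysm_psum k).
Proof.
move=> n i; rewrite /plethysm_psum rmorphB /= map_polyC /=.
rewrite hornerD hornerN hornerC map_polyZ /= map_polyXn.
rewrite hornerZ hornerXn /GRing.in_alg componentZ rmorph1 -scalerAl mul1r.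
have -> : component n (psum F k) = \sum_(j < n) 'X_j ^+ k.+1 by [].
rewrite shrink_var_sum (bigD1 i) //= [RHS](bigD1 i) //=.
rewrite shrink_varXn eqxx scalerBl scale1r exprZn exprVn opprB.
have -> (V : zmodType) (x y z : V) : x + z + (y - x) = y + z.
  by rewrite addrC addrA subrK.
congr (_ + _); apply: eq_bigr => j /negbTE ji.
by rewrite shrink_varXn ji.
Qed.

Lemma is_plethysm_eval N (P : {mpoly F[N]}) :
  is_plethysm (mmap (in_alg Lambda) (fun i : 'I_N => psum F i : Lambda) P)
    (mmap (fun c => (in_alg Lambda c)%:P) (fun i : 'I_N => plethysm_psum i) P).
Proof.
apply: is_plethysm_sum => m; apply: is_plethysmM; first exact: is_plethysmC.
by apply: is_plethysm_prod => i; apply: is_plethysmX; apply: is_plethysm_psum.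
Qed.
End SymfunPlethysm.

(** * Newton's identity and the subalgebra generated by the power sums *)

Section PowerSums.
Variable F : fieldType.
Local Notation Lambda := (symfun F).

Lemma mcoeffXnM n (i : 'I_n) k (f : {mpoly F[n]}) m :
  ('X_i ^+ k * f)@_m = if (k <= m i)%N then f@_(m - U_(i) *+ k)%MM else 0.
Proof.
rewrite mulrC mpolyXn; case: ifP => km.
  have le : (U_(i) *+ k <= m)%MM.
    apply/mnm_lepP => j; rewrite mulmnE mnm1E.
    by case: eqP => [<-|]; rewrite ?mul1n ?mul0n.
  by rewrite -{1}(submK le) addmC mcoeffMX.
rewrite mcoeffM big1 // => -[/= m1 m2] /eqP mE.
rewrite mcoeffX; case: eqP => [e|_]; last by rewrite mulr0.
move: km; rewrite (congr1 (fun m' : 'X_{1..n} => m' i) mE) -e.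
by rewrite mnmDE mulmnE mnm1E eqxx mul1n leq_addl.
Qed.

Lemma mcoeff_psumM n k (f : {mpoly F[n]}) m :
  (component n (psum F k.-1) * f)@_m =
  \sum_(i < n) if (k.-1.+1 <= m i)%N then f@_(m - U_(i) *+ k.-1.+1)%MM else 0.
Proof.
rewrite -[component n _]/(\sum_(i < n) 'X_i ^+ k.-1.+1) mulr_suml raddf_sum /=.
by apply: eq_bigr => i _; rewrite mcoeffXnM.
Qed.

Lemma mcoeff_hsum n r m : (component n (hsum F r))@_m = (mdeg m == r)%:R.
Proof.
rewrite -[component n _]/(hsum_family F r n) /hsum_family.
by rewrite (mcoeff_sumX _ (P := fun e => mdeg e == r)) // => e /eqP ->.
Qed.

Lemma mcoeff_msum n mu m : (component n (msum F mu))@_m = (perm_eq (exponents m) mu)%:R.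
Proof.
rewrite -[component n _]/(msum_family F mu n) /msum_family.
rewrite (mcoeff_sumX _ (P := fun e => perm_eq (exponents e) mu)) // => e /perm_sumn.
by rewrite -mdeg_exponents ltnS => ->.
Qed.

Lemma mdegB_var n (m : 'X_{1..n}) (i : 'I_n) k :
  (k <= m i)%N -> mdeg (m - U_(i) *+ k)%MM = (mdeg m - k)%N.
Proof.
move=> km; rewrite !mdegE (bigD1 i) //= [in RHS](bigD1 i) //=.
rewrite mnmBE mulmnE mnm1E eqxx mul1n -addnBAC //; congr (_ + _)%N.
apply: eq_bigr => j /negbTE ji.
by rewrite mnmBE mulmnE mnm1E eq_sym ji mul0n subn0.
Qed.

(** For a monomial of degree [r], the pairs of a variable [x_i] and an exponent
    [1 <= k <= m i] by which it may be divided are as many as its degree. *)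
Lemma hsum_newton r :
  r%:R *: hsum F r = \sum_(1 <= k < r.+1) psum F k.-1 * hsum F (r - k) :> Lambda.
Proof.
apply: symfun_eq => n; apply/mpolyP => m.
rewrite componentZ mcoeffZ mcoeff_hsum mcoeff_component_sum.
have [dm|dm] := eqVneq (mdeg m) r; last first.
  rewrite mulr0 big_nat big1 // => k /andP[k0 kr].
  rewrite componentM mcoeff_psumM big1 // => i _; rewrite prednK //.
  case: ifP => // km; rewrite mcoeff_hsum mdegB_var // -(inj_eq (@addIn k)) !subnK //.
    by rewrite (negbTE dm).
  by rewrite (leq_trans km) // mdegE (bigD1 i) //= leq_addr.
rewrite mulr1 -{1}dm mdegE natr_sum.
rewrite (eq_big_nat _ _ (F2 := fun k => \sum_(i < n) (k <= m i)%N%:R)).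
  rewrite exchange_big /=; apply: eq_bigr => i _.
  have mir : (m i <= r)%N by rewrite -dm mdegE (bigD1 i) //= leq_addr.
  rewrite (big_cat_nat (n := (m i).+1)) //=.
  rewrite [X in _ + X]big_nat [X in _ + X]big1 ?addr0; last first.
    by move=> k /andP[mk _]; rewrite leqNgt mk.
  rewrite big_nat (eq_bigr (fun=> 1)) => [|k /andP[_]]; last by rewrite ltnS => ->.
  by rewrite -big_nat sumr_const_nat subn1.
move=> k /andP[k0 kr].
rewrite componentM mcoeff_psumM; apply: eq_bigr => i _; rewrite prednK //.
by case: ifP => // km; rewrite mcoeff_hsum mdegB_var // dm eqxx.
Qed.

Lemma hsum0 : hsum F 0 = 1 :> Lambda.
Proof.
apply: symfun_eq => n; apply/mpolyP => m; rewrite mcoeff_hsum.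
by rewrite -[component n _]/(1 : {mpoly F[n]}) mcoeff1 mdeg_eq0.
Qed.

(** The number [N] of power sums is fixed here so that sums and products are
    inherited from [{mpoly F[N]}]; [psum_gen_leq] then lets [N] grow. *)
Definition psum_gen N (f : Lambda) : Prop :=
  exists P : {mpoly F[N]}, mmap (in_alg Lambda) (fun i : 'I_N => psum F i : Lambda) P = f.

Lemma psum_genC N c : psum_gen N c%:A.
Proof. by exists c%:MP; rewrite mmapC. Qed.

Lemma psum_gen_psum N k : (k < N)%N -> psum_gen N (psum F k).
Proof. by move=> kN; exists 'X_(Ordinal kN); rewrite mmapX mmap1U. Qed.

Lemma psum_genD N f g : psum_gen N f -> psum_gen N g -> psum_gen N (f + g).
Proof. by case=> P <- [Q <-]; exists (P + Q); rewrite mmapD. Qed.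

Lemma psum_genM N f g : psum_gen N f -> psum_gen N g -> psum_gen N (f * g).
Proof. by case=> P <- [Q <-]; exists (P * Q); rewrite rmorphM. Qed.

Lemma psum_gen_leq N N' f : (N <= N')%N -> psum_gen N f -> psum_gen N' f.
Proof.
move=> NN' [P <-]; rewrite /mmap; apply: big_ind => [||m _].
- by rewrite -[0](scale0r 1); apply: psum_genC.
- exact: psum_genD.
apply: psum_genM; first exact: psum_genC.
rewrite /mmap1; apply: big_ind => [||i _].
- by rewrite -[1](scale1r 1); apply: psum_genC.
- exact: psum_genM.
elim: (m i) => [|k IHk]; first by rewrite expr0 -[1](scale1r 1); apply: psum_genC.
rewrite exprS; apply: psum_genM => //; apply: psum_gen_psum.
exact: leq_trans (ltn_ord i) NN'.
Qed.

Definition psum_subalg : {pred Lambda} := fun f => `[< exists N, psum_gen N f >].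

Fact psum_subalg_closed : subalg_closed psum_subalg.
Proof.
have lift f g : f \in psum_subalg -> g \in psum_subalg ->
    exists N, psum_gen N f /\ psum_gen N g.
  move=> /asboolP[N fN] /asboolP[N' gN]; exists (maxn N N').
  by split; [apply: psum_gen_leq fN|apply: psum_gen_leq gN]; rewrite ?leq_maxl ?leq_maxr.
split.
- by apply/asboolP; exists 0%N; rewrite -[1](scale1r 1); apply: psum_genC.
- move=> a f g fS gS; have [N [fN gN]] := lift _ _ fS gS.
  apply/asboolP; exists N; apply: psum_genD => //.
  by rewrite -[f]mul1r scalerAl; apply: psum_genM => //; apply: psum_genC.
- move=> f g fS gS; have [N [fN gN]] := lift _ _ fS gS.
  by apply/asboolP; exists N; apply: psum_genM.
Qed.
HB.instance Definition _ := GRing.isSubalgClosed.Build F Lambda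
  psum_subalg psum_subalg_closed.

Lemma psum_in_subalg k : (psum F k : Lambda) \in psum_subalg.
Proof. by apply/asboolP; exists k.+1; apply: psum_gen_psum. Qed.

(** Newton's identity solved for [h_r], which divides by [r]. *)
Lemma hsum_in_subalg r : (forall n, n.+1%:R != 0 :> F) -> (hsum F r : Lambda) \in psum_subalg.
Proof.
move=> char0; elim/ltn_ind: r => -[|r] IHr; first by rewrite hsum0 rpred1.
rewrite -[hsum F _](scalerK (char0 r)) hsum_newton rpredZ // big_nat rpred_sum //.
move=> k /andP[k0 kr]; rewrite rpredM ?psum_in_subalg // IHr //.
by rewrite ltn_subrL k0.
Qed.
End PowerSums.

(** * Augmented monomial functions and their products with power sums *)

Definition mult_fact (A : seq nat) : nat :=
  \prod_(0 <= i < (sumn A).+1) (count_mem i A)`!.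

Lemma leq_sumn (x : nat) (A : seq nat) : x \in A -> (x <= sumn A)%N.
Proof. by move=> xA; rewrite (perm_sumn (perm_to_rem xA)) leq_addr. Qed.

Lemma mult_fact_widen A N : (sumn A < N)%N ->
  mult_fact A = (\prod_(0 <= i < N) (count_mem i A)`!)%N.
Proof.
move=> AN; rewrite (big_cat_nat (n := (sumn A).+1)) //= -[LHS]muln1; congr muln.
rewrite big_nat big1 // => i /andP[iA _]; have /count_memPn -> // : i \notin A.
by apply/negP => /leq_sumn; rewrite leqNgt iA.
Qed.

Lemma perm_mult_fact A B : perm_eq A B -> mult_fact A = mult_fact B.
Proof.
move=> AB; rewrite /mult_fact (perm_sumn AB); apply: eq_bigr => i _.
by rewrite (permP AB).
Qed.

Lemma mult_fact_cons x A : mult_fact (x :: A) = ((count_mem x A).+1 * mult_fact A)%N.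
Proof.
rewrite (@mult_fact_widen A (sumn (x :: A)).+1) ?ltnS ?leq_addl // /mult_fact !big_mkord.
have xl : (x < (sumn (x :: A)).+1)%N by rewrite ltnS leq_addr.
rewrite (bigD1 (Ordinal xl)) //= [in RHS](bigD1 (Ordinal xl)) //= eqxx factS mulnA.
congr (_ * _)%N; apply: eq_bigr => i; rewrite -val_eqE /= eq_sym => /negbTE -> //.
Qed.

(** The lists obtained by adding [n] to one entry, counted with multiplicity. *)
Fixpoint bumps n (A : seq nat) : seq (seq nat) :=
  if A is x :: A' then ((x + n)%N :: A') :: [seq x :: B | B <- bumps n A'] else [::].

Lemma sum_bumps n A (f : seq nat -> nat) :
  (forall B C, perm_eq B C -> f B = f C) ->
  (\sum_(B <- bumps n A) f B = \sum_(x <- A) f ((x + n)%N :: rem x A))%N.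
Proof.
elim: A f => [|a A IHA] f fperm; first by rewrite !big_nil.
rewrite !big_cons /= eqxx big_map IHA => [|B C BC]; last by apply: fperm; rewrite perm_cons.
congr (_ + _)%N; rewrite big_seq [RHS]big_seq; apply: eq_bigr => x xA; apply: fperm.
rewrite (perm_catCA [:: a] [:: (x + n)%N]) perm_cons.
by case: eqVneq => [->|//]; rewrite perm_sym perm_to_rem.
Qed.

Lemma sum_eq_count (A : seq nat) (x0 : nat) (g : nat -> nat) :
  (\sum_(x <- A) (x == x0) * g x = count_mem x0 A * g x0)%N.
Proof.
elim: A => [|a A IHA]; first by rewrite big_nil.
by rewrite big_cons IHA /= mulnDl; case: eqVneq => [->|].
Qed.

Lemma count_exponents n (m : 'X_{1..n}) k : (0 < k)%N ->
  (\sum_(i < n) (m i == k) = count_mem k (exponents m))%N.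
Proof.
move=> k0; rewrite count_filter count_map -sum1_count big_enum_cond /= [RHS]big_mkcond /=.
by apply: eq_bigr => i _; case: eqVneq => //= ->; rewrite -lt0n k0.
Qed.

(** Dividing by [x_i ^ k] either removes the part [k] or shortens the part
    [m i] to [m i - k]. *)
Lemma exponents_shift n (m : 'X_{1..n}) (i : 'I_n) k (A : seq nat) :
  (0 < k <= m i)%N -> positive A ->
  perm_eq (exponents (m - U_(i) *+ k)%MM) A =
  if m i == k then perm_eq (exponents m) (k :: A)
  else (m i - k \in A)%N && perm_eq (exponents m) (m i :: rem (m i - k)%N A).
Proof.
move=> /andP[k0 km] A0.
pose R (m' : 'X_{1..n}) := [seq e <- [seq m' j | j <- rem i (enum 'I_n)] | e != 0%N].
have split m' : perm_eq (exponents m') ((if m' i == 0%N then [::] else [:: m' i]) ++ R m').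
  have : perm_eq (enum 'I_n) (i :: rem i (enum 'I_n)) by rewrite perm_to_rem // mem_enum.
  move=> /(perm_map (fun j => m' j)) /(perm_filter (fun e => e != 0%N)) /permPl.
  by rewrite /exponents => -> /=; case: eqP.
rewrite (permPl (split (m - U_(i) *+ k)%MM)) !(permPl (split m)).
have -> : R (m - U_(i) *+ k)%MM = R m.
  congr filter; apply/eq_in_map => j; rewrite rem_filter ?enum_uniq // mem_filter /= => /andP[ji _].
  by rewrite mnmBE mulmnE mnm1E eq_sym (negbTE ji) mul0n subn0.
rewrite mnmBE mulmnE mnm1E eqxx mul1n [m i == 0%N](_ : _ = false); last first.
  by apply/eqP => m0; move: km; rewrite m0 leqNgt k0.
rewrite subn_eq0; case: ltngtP km => // [km|mk] _ /=; last by rewrite mk perm_cons.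
rewrite perm_cons; apply/idP/andP => [p|[xA p]].
  have xA : (m i - k \in A)%N by rewrite -(perm_mem p) mem_head.
  split=> //; rewrite -(perm_cons (m i - k)%N).
  by apply: perm_trans p _; apply: perm_to_rem.
by rewrite (perm_trans (_ : perm_eq _ ((m i - k)%N :: rem (m i - k)%N A))) ?perm_cons // perm_sym perm_to_rem.
Qed.

(** The coefficient of a monomial in the product of [p_k] and an augmented
    monomial function.  A variable of exponent [k] in the monomial comes from a
    new part [k]; one of exponent [x + k] comes from a part [x].  The factorials
    compensate for the number of variables with the same exponent, by
    [mult_fact_cons]. *)
Lemma mult_fact_psum_count n (m : 'X_{1..n}) k (A : seq nat) :
  (0 < k)%N -> positive A ->
  (mult_fact A * (\sum_(i < n) ((k <= m i)%N && perm_eq (exponents (m - U_(i) *+ k)%MM) A)) =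
   mult_fact (k :: A) * perm_eq (exponents m) (k :: A) +
   \sum_(B <- bumps k A) mult_fact B * perm_eq (exponents m) B)%N.
Proof.
move=> k0 A0; rewrite sum_bumps => [|B C BC]; last first.
  by rewrite (perm_mult_fact BC) (permPr BC).
pose B x := ((x + k)%N :: rem x A).
transitivity (\sum_(i < n) (((m i == k) * perm_eq (exponents m) (k :: A) * mult_fact A)
   + \sum_(x <- A) (x + k == m i)%N * (perm_eq (exponents m) (B x) * mult_fact (rem x A))))%N.
  rewrite big_distrr /=; apply: eq_bigr => i _.
  case: (leqP k (m i)) => [km|mk] /=; last first.
    rewrite muln0 (ltn_eqF mk) !mul0n add0n big1 // => x _.
    by case: eqP mk => // <-; rewrite ltnNge leq_addl.
  rewrite exponents_shift ?k0 //.
  case: eqP => [mik|/eqP mik].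
    rewrite mul1n mulnC mik [X in (_ + X)%N]big_seq [X in (_ + X)%N]big1 ?addn0 // => x xA.
    by rewrite -[X in _ == X]add0n eqn_add2r eqn0Ngt A0.
  rewrite !mul0n add0n.
  rewrite (eq_bigr (fun x => (x == m i - k)%N * (perm_eq (exponents m) (B x) * mult_fact (rem x A))))%N; last first.
    by move=> x _; rewrite -(eqn_add2r k x) subnK.
  rewrite sum_eq_count /B subnK //.
  have [xA|xA] := boolP (m i - k \in A)%N; last first.
    by rewrite (count_memPn xA) mul0n muln0.
  rewrite (perm_mult_fact (perm_to_rem xA)) mult_fact_cons /=.
  by rewrite (permP (perm_to_rem xA)) /= eqxx; lia.
rewrite big_split /=; congr (_ + _)%N.
  rewrite -big_distrl -big_distrl /= count_exponents //.
  case: (boolP (perm_eq _ _)) => [p|_]; last by rewrite !muln0 mul0n.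
  by rewrite (permP p) /= eqxx mult_fact_cons !muln1.
rewrite exchange_big /= [LHS]big_seq [RHS]big_seq; apply: eq_bigr => x xA.
rewrite -big_distrl /=.
rewrite (eq_bigr (fun i => (m i == x + k)%N : nat)); last by move=> i _; rewrite eq_sym.
rewrite count_exponents ?addn_gt0 ?k0 ?orbT // /B.
case: (boolP (perm_eq _ _)) => [p|_]; last by rewrite !mul0n !muln0.
by rewrite (permP p) /= eqxx mult_fact_cons mul1n muln1.
Qed.

Section AugmentedMonomial.
Variable F : fieldType.
Local Notation Lambda := (symfun F).

Definition spsum n : Lambda := (-1) ^+ n.-1 *: psum F n.-1.

Lemma spsum_in n : spsum n \in psum_subalg (F := F).
Proof. by rewrite rpredZ // psum_in_subalg. Qed.

Definition aug_sym (A : seq nat) : Lambda :=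
  ((-1) ^+ (sumn A - size A) * (mult_fact A)%:R) *: msum F A.

Lemma perm_aug_sym A B : perm_eq A B -> aug_sym A = aug_sym B.
Proof.
move=> AB; rewrite /aug_sym (perm_sumn AB) (perm_size AB) (perm_mult_fact AB).
congr (_ *: _); apply: symfun_eq => n; apply/mpolyP => m; rewrite !mcoeff_msum.
by rewrite (permPr AB).
Qed.

Lemma aug_sym_nil : aug_sym [::] = 1.
Proof.
rewrite /aug_sym /mult_fact big_nat1 /= mul1r scale1r; apply: symfun_eq => n; apply/mpolyP => m.
rewrite mcoeff_msum -[component n 1]/(1 : {mpoly F[n]}) mcoeff1 -mdeg_eq0 mdeg_exponents.
congr (nat_of_bool _)%:R; apply/idP/idP => [/perm_sumn -> //|].
rewrite -[perm_eq _ _]perm_sym.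
case E: (exponents m) => [//|x s] /=; rewrite addn_eq0 => /andP[/eqP x0 _].
have : x \in exponents m by rewrite E mem_head.
by rewrite /exponents mem_filter x0.
Qed.

Lemma psum_aug k (A : seq nat) : (0 < k)%N -> positive A ->
  psum F k.-1 * ((mult_fact A)%:R *: msum F A) =
  (mult_fact (k :: A))%:R *: msum F (k :: A)
  + \sum_(B <- bumps k A) (mult_fact B)%:R *: msum F B :> Lambda.
Proof.
move=> k0 A0; apply: symfun_eq => n; apply/mpolyP => m.
rewrite componentM mcoeff_psumM prednK // componentD mcoeffD mcoeff_component_sum.
rewrite !componentZ !mcoeffZ mcoeff_msum.
under [X in _ = _ + X]eq_bigr => B _ do rewrite componentZ mcoeffZ mcoeff_msum -natrM.
rewrite -natr_sum -natrM -natrD -mult_fact_psum_count // natrM natr_sum mulr_sumr.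
apply: eq_bigr => i _; case: leqP => _; last by rewrite mulr0.
by rewrite mcoeffZ mcoeff_msum.
Qed.

Lemma bumpsP n A B : B \in bumps n A ->
  sumn B = (sumn A + n)%N /\ size B = size A.
Proof.
elim: A B => //= x A IHA B; rewrite inE => /predU1P[->|/mapP[B' /IHA[s1 s2] ->]] /=.
  by split=> //; lia.
by rewrite s1 s2; split=> //; lia.
Qed.

Lemma bumps_positive n (A B : seq nat) : positive A -> B \in bumps n A ->
  forall x, x \in B -> (0 < x)%N.
Proof.
elim: A B => //= a A IHA B A0; rewrite inE => /predU1P[->|/mapP[B' B'A ->]] x; rewrite inE => /predU1P[->|xB].
- by rewrite addn_gt0 A0 ?mem_head.
- by rewrite A0 // inE xB orbT.
- by rewrite A0 ?mem_head.
- by apply: IHA B'A _ xB => y yA; rewrite A0 // inE yA orbT.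
Qed.

Lemma size_leq_sumn (A : seq nat) : positive A -> (size A <= sumn A)%N.
Proof.
elim: A => //= a A IHA A0; rewrite -add1n leq_add ?A0 ?mem_head // IHA // => x xA.
by rewrite A0 // inE xA orbT.
Qed.

(** Adding a part [k] to [A] changes the sign exponent [sumn A - size A] by
    [k - 1], merging [k] into a part changes it by [k]: hence the minus sign. *)
Lemma spsum_aug_sym k (A : seq nat) : (0 < k)%N -> positive A ->
  spsum k * aug_sym A = aug_sym (k :: A) - \sum_(B <- bumps k A) aug_sym B.
Proof.
move=> k0 A0; rewrite /spsum /aug_sym -scalerA -scalerAl -scalerAr psum_aug // !scalerDr.
have leA := size_leq_sumn A0; congr (_ + _).
  by rewrite !scalerA -exprD /=; congr ((_ ^+ _ * _) *: _); lia.
rewrite !scaler_sumr -sumrN !big_seq; apply: eq_bigr => B /bumpsP[-> ->].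
have oppX e : - (-1) ^+ e = (-1) ^+ e.+1 :> F by rewrite exprS mulN1r.
rewrite !scalerA -exprD -scaleNr -mulNr oppX; congr ((_ * _) *: _).
by rewrite -[LHS]signr_odd -[RHS]signr_odd; congr (_ ^+ nat_of_bool _); lia.
Qed.
End AugmentedMonomial.

(** * Splitting a list of parts *)

Fixpoint splits (A : seq nat) : seq (seq nat * seq nat) :=
  if A is x :: A' then
    [seq (x :: YD.1, YD.2) | YD <- splits A'] ++ [seq (YD.1, x :: YD.2) | YD <- splits A']
  else [:: ([::], [::])].

(** Enlarging an entry and splitting commute: the enlarged entry lies on one of
    the two sides. *)
Lemma sum_splits_bumps (V : nmodType) n A (f : seq nat -> seq nat -> V) :
  \sum_(B <- bumps n A) \sum_(YD <- splits B) f YD.1 YD.2 =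
  \sum_(YD <- splits A) (\sum_(Y <- bumps n YD.1) f Y YD.2 + \sum_(D <- bumps n YD.2) f YD.1 D).
Proof.
elim: A f => [|x A IHA] f; first by rewrite /= big_nil big_seq1 !big_nil addr0.
rewrite /= big_cons big_map /= !big_cat !big_map /=.
under [X in _ + X = _]eq_bigr => B _ do rewrite /= big_cat !big_map /=.
rewrite big_split (IHA (fun Y D => f (x :: Y) D)) (IHA (fun Y D => f Y (x :: D))) /=.
rewrite addrACA -!big_split /=; apply: eq_bigr => YD _.
rewrite !big_cons !big_map; congr (_ + _); first by rewrite addrA.
by rewrite addrCA.
Qed.

Lemma splits_perm A YD : YD \in splits A -> perm_eq A (YD.1 ++ YD.2).
Proof.
elim: A YD => [|x A IHA] YD; first by rewrite inE => /eqP ->.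
rewrite mem_cat => /orP[] /mapP[[Y D] /IHA /= p ->] /=; first by rewrite perm_cons.
by rewrite (perm_trans (_ : perm_eq _ (x :: Y ++ D))) ?perm_cons // (perm_catCA [:: x]).
Qed.

(** Each entry stays unchanged in all members of [bumps n A] but one. *)
Lemma sum_sum_bumps (V : zmodType) n A (g : nat -> V) :
  \sum_(B <- bumps n A) \sum_(y <- B) g y =
  (\sum_(y <- A) g y) *+ size A - \sum_(y <- A) g y + \sum_(y <- A) g (y + n)%N.
Proof.
elim: A => [|x A IHA]; first by rewrite !big_nil mulr0n subr0 addr0.
rewrite /= !big_cons big_map.
under [X in _ + X = _]eq_bigr => B _ do rewrite big_cons.
rewrite big_split /= IHA big_const_seq count_predT iter_addr_0.
have -> : size (bumps n A) = size A by elim: (A) => //= a A' IH; rewrite size_map IH.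
set S := \sum_(y <- A) g y; set T := \sum_(y <- A) _.
rewrite mulrS mulrnDl; move: (S *+ size A) (g x *+ size A) => U W.
by rewrite [g x + S + (W + U)]addrC addrK [U - S + T]addrAC [W + (_ - S)]addrA addrACA subrr addr0 [W + (_ + _)]addrA addrCA.
Qed.

(** * The operators C and multiplication by power sums *)

Section Operators.
Variables (F : fieldType) (q : F).
Hypotheses (char0 : forall n, n.+1%:R != 0 :> F) (q_neq0 : q != 0).
Local Notation Lambda := (symfun F).
Local Notation G := (psum_subalg (F := F)).
(* Any map that computes the plethysm on polynomials in the power sums. *)
Variable pl : Lambda -> {poly Lambda}.
Hypothesis plP : forall f, f \in G -> is_plethysm q f (pl f).

Lemma pl_eq f Q : f \in G -> is_plethysm q f Q -> pl f = Q.
Proof. by move=> fG; apply: is_plethysm_unique (plP fG). Qed.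

Lemma pl1 : pl 1 = 1.
Proof. by apply: pl_eq; rewrite ?rpred1 //; apply: is_plethysm1. Qed.

Lemma plD f g : f \in G -> g \in G -> pl (f + g) = pl f + pl g.
Proof.
by move=> fG gG; apply: pl_eq; rewrite ?rpredD //; apply: is_plethysmD; apply: plP.
Qed.

Lemma plZ c f : f \in G -> pl (c *: f) = c%:A *: pl f.
Proof.
move=> fG; apply: pl_eq; rewrite ?rpredZ // -mul_polyC -[f in c *: f]mul1r scalerAl.
by apply: is_plethysmM; [apply: is_plethysmC | apply: plP].
Qed.

Lemma pl_psum k f : f \in G ->
  pl ((psum F k : Lambda) * f) =
  (psum F k : Lambda) *: pl f - (1 - q ^- k.+1)%:A *: ('X^(k.+1) * pl f).
Proof.
move=> fG; have -> (c d : Lambda) (Q Q' : {poly Lambda}) :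
    c *: Q - d *: (Q' * Q) = (c%:P - d *: Q') * Q.
  by rewrite mulrBl mul_polyC scalerAl.
apply: pl_eq; first by rewrite rpredM // psum_in_subalg.
by apply: is_plethysmM; [apply: is_plethysm_psum | apply: plP].
Qed.

Lemma pl_over f : f \in G -> pl f \is a polyOver G.
Proof.
move=> /[dup] fG /asboolP[N [P fP]].
rewrite (pl_eq fG (Q := mmap (fun c => (c%:A : Lambda)%:P)
                             (fun i : 'I_N => plethysm_psum q i) P)); last first.
  by rewrite -fP; apply: is_plethysm_eval.
apply: rpred_sum => m _; apply: rpredM.
  by rewrite polyOverC rpredZ ?rpred1.
apply: rpred_prod => i _; apply: rpredX; rewrite /plethysm_psum rpredB //.
  by rewrite polyOverC psum_in_subalg.
by rewrite polyOverZ ?rpredZ ?rpred1 // polyOverXn.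
Qed.

(** The coefficient of [z^a] in [Q(z^-1) * sum_r h_r z^r]. *)
Definition hpair a (Q : {poly Lambda}) : Lambda := \sum_(j < size Q) Q`_j * hsum F (a + j).

Lemma hpair_leq a (Q : {poly Lambda}) n : (size Q <= n)%N ->
  hpair a Q = \sum_(j < n) Q`_j * hsum F (a + j).
Proof.
move=> Qn; rewrite /hpair (big_ord_widen _ (fun j => Q`_j * hsum F (a + j)) Qn).
rewrite big_mkcond; apply: eq_bigr => j _; case: ltnP => // jQ.
by rewrite nth_default // mul0r.
Qed.

Lemma hpairD a Q R : hpair a (Q + R) = hpair a Q + hpair a R.
Proof.
rewrite !(@hpair_leq a _ (maxn (size Q) (size R))) ?leq_maxl ?leq_maxr ?size_polyD //.
by rewrite -big_split; apply: eq_bigr => j _; rewrite coefD mulrDl.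
Qed.

Lemma hpairZ a c Q : hpair a (c *: Q) = c * hpair a Q.
Proof.
rewrite (@hpair_leq a _ (size Q)) ?size_scale_leq // mulr_sumr.
by apply: eq_bigr => j _; rewrite coefZ mulrA.
Qed.

Lemma hpairXn a k Q : hpair a ('X^k * Q) = hpair (a + k) Q.
Proof.
rewrite (@hpair_leq a _ (k + size Q)); last first.
  by rewrite (leq_trans (size_polyMleq _ _)) // size_polyXn addSn.
rewrite big_split_ord /= big1 ?add0r => [|j _]; last by rewrite coefXnM ltn_ord mul0r.
by apply: eq_bigr => j _; rewrite coefXnM ltnNge leq_addr addKn addnA.
Qed.

Definition Cop a (f : Lambda) : Lambda := (- q^-1) ^+ a.-1 *: hpair a (pl f).

Lemma CopD a f g : f \in G -> g \in G -> Cop a (f + g) = Cop a f + Cop a g.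
Proof. by move=> fG gG; rewrite /Cop plD // hpairD scalerDr. Qed.

Lemma CopZ a c f : f \in G -> Cop a (c *: f) = c *: Cop a f.
Proof.
by move=> fG; rewrite /Cop plZ // hpairZ -scalerAl mul1r !scalerA mulrC.
Qed.

Lemma CopB a f g : f \in G -> g \in G -> Cop a (f - g) = Cop a f - Cop a g.
Proof. by move=> fG gG; rewrite -scaleN1r CopD ?rpredZ // CopZ // scaleN1r. Qed.

Lemma Cop_in a f : f \in G -> Cop a f \in G.
Proof.
move=> fG; rewrite rpredZ // rpred_sum // => j _.
by rewrite rpredM ?hsum_in_subalg // (polyOverP (pl_over fG)).
Qed.

Lemma Cop0 a : Cop a 0 = 0.
Proof. by rewrite -[X in Cop _ X](scale0r (0 : Lambda)) CopZ ?rpred0 // scale0r. Qed.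

Lemma Cop_sum a (I : eqType) (s : seq I) (f : I -> Lambda) :
  (forall i, i \in s -> f i \in G) ->
  Cop a (\sum_(i <- s) f i) = \sum_(i <- s) Cop a (f i).
Proof.
elim: s => [|i s IHs] fG; first by rewrite !big_nil Cop0.
rewrite !big_cons CopD ?fG ?mem_head ?IHs //.
  by move=> j js; apply: fG; rewrite inE js orbT.
by rewrite big_seq rpred_sum // => j js; apply: fG; rewrite inE js orbT.
Qed.

Lemma Cop1 a : Cop a 1 = (- q^-1) ^+ a.-1 *: hsum F a.
Proof.
by rewrite /Cop pl1 /hpair size_poly1 big_ord1 coef1 eqxx mul1r addn0.
Qed.

(** The second summand of [p_n - (1 - q^-n) z^-n] shifts the extracted power of
    [z] from [a] to [a + n]; comparing the prefactors [(-1/q)^(a-1)] and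
    [(-1/q)^(a+n-1)] turns [1 - q^-n] into [q^n - 1]. *)
Lemma Cop_spsum a n f : (0 < a)%N -> (0 < n)%N -> f \in G ->
  spsum F n * Cop a f = Cop a (spsum F n * f) - (q ^+ n - 1) *: Cop (a + n) f.
Proof.
case: a n => [|a] [|n] // _ _ fG; rewrite /spsum -[in RHS]scalerAl CopZ; last first.
  by rewrite rpredM ?psum_in_subalg.
rewrite /Cop pl_psum // hpairD -scaleNr !hpairZ hpairXn.
set Ha := hpair a.+1 _; set Hb := hpair (a.+1 + n.+1) _.
rewrite mulNr -[in RHS]scalerAl mul1r scalerBr scalerBr -addrA -opprD addSn /=.
rewrite !scalerA -scalerDl [X in X *: Hb](_ : _ = 0); last first.
  have -> : (- q^-1) ^+ (a + n.+1) = (- q^-1) ^+ a * - ((-1) ^+ n * q ^- n.+1).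
    by rewrite exprD [X in _ * X]exprNn exprVn exprS mulN1r mulNr.
  have := expf_neq0 n.+1 q_neq0; move: (q ^+ n.+1) => x x0.
  by field.
by rewrite scale0r subr0 -scalerA scalerAr scalerAl.
Qed.

Local Notation C := (Cop).
Local Notation M := (aug_sym F).

(** * Expansion of an augmented monomial function *)

Lemma positive_cons x A : (0 < x)%N -> positive A -> positive (x :: A).
Proof. by move=> x0 A0 y; rewrite inE => /predU1P[->|/A0]. Qed.

Lemma aug_sym_in A : positive A -> M A \in G.
Proof.
elim: {A}(size A) {-2}A (erefl (size A)) => [|k IHk] [|n A] // => [_|[sA]] A0.
  by rewrite aug_sym_nil rpred1.
have A0' : positive A by move=> x xA; rewrite A0 // inE xA orbT.
have := spsum_aug_sym F (A0 n (mem_head _ _)) A0' => /(canLR (subrK _)) <-.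
rewrite rpredD ?rpredM ?spsum_in ?IHk // big_seq rpred_sum // => B BA.
by apply: IHk; [rewrite (bumpsP BA).2 | apply: bumps_positive BA].
Qed.

Lemma spsum_C a n D : (0 < a)%N -> (0 < n)%N -> positive D ->
  spsum F n * C a (M D) =
  C a (M (n :: D)) - \sum_(B <- bumps n D) C a (M B) - (q ^+ n - 1) *: C (a + n) (M D).
Proof.
move=> a0 n0 D0; rewrite Cop_spsum ?aug_sym_in //; congr (_ - _).
have Dn0 B : B \in bumps n D -> M B \in G by move=> BD; apply: aug_sym_in (bumps_positive D0 BD).
rewrite spsum_aug_sym // CopB ?Cop_sum ?aug_sym_in //; first exact: positive_cons.
by rewrite big_seq rpred_sum.
Qed.

Definition qint n : F := \sum_(i < n) q ^+ i.

(** The coefficient [k(r,Y)], for the parts [r :: Y] being consumed completely. *)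
Definition full_coef r Y : F := (size Y)`!%:R * \sum_(y <- r :: Y) qint y.

(** The bracket in [kappa(r,Y,w)].  Writing [q^(r-w-1)] as a quotient lets it be
    factored out of [q^(r+y-w-1)] when [w >= r] too, so that the recurrences in
    [r] and [w] hold without case distinction on the exponents. *)
Definition rest_coef1 r w y : F :=
  ((w <= y)%N%:R * q ^+ y - (w < r)%N%:R * (q ^+ y - 1)) * (q ^+ r / q ^+ w.+1).

Definition rest_coef r Y w : F :=
  if Y is [::] then (w < r)%N%:R * (q ^+ r / q ^+ w.+1)
  else (size Y).-1`!%:R * \sum_(y <- Y) rest_coef1 r w y.

Lemma qintD m n : qint (m + n) = qint n + q ^+ n * qint m.
Proof.
rewrite /qint addnC big_split_ord /= mulr_sumr; congr (_ + _).
by apply: eq_bigr => i _; rewrite exprD.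
Qed.

(** Multiplying by [P_n] adds [n] to the parts [r :: Y] in three ways: to [r], to
    an entry of [Y], or inside [C] by the commutation relation.  Together they
    account for a further consumed part [n]. *)
Lemma full_coef_rec r n Y :
  full_coef (r + n) Y + \sum_(Y' <- bumps n Y) full_coef r Y' - (q ^+ n - 1) * full_coef r Y
  = full_coef r (n :: Y).
Proof.
have -> : \sum_(Y' <- bumps n Y) full_coef r Y' =
    (size Y)`!%:R * (qint r *+ size Y + \sum_(Y' <- bumps n Y) \sum_(y <- Y') qint y).
  have <- : \sum_(Y' <- bumps n Y) qint r = qint r *+ size Y.
    rewrite big_const_seq count_predT iter_addr_0; congr (_ *+ _).
    by elim: (Y) => //= a A' IH; rewrite size_map IH.
  rewrite -big_split mulr_sumr big_seq [RHS]big_seq; apply: eq_bigr => B /bumpsP[_ sB].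
  by rewrite /full_coef sB big_cons.
rewrite sum_sum_bumps /full_coef !big_cons.
have -> : \sum_(y <- Y) qint (y + n) = qint n *+ size Y + q ^+ n * \sum_(y <- Y) qint y.
  under eq_bigr => y _ do rewrite qintD.
  by rewrite big_split -mulr_sumr /= big_const_seq count_predT iter_addr_0.
rewrite qintD factS natrM -natr1 -[_ *+ size Y]mulr_natr -[qint n *+ size Y]mulr_natr.
rewrite -[(\sum_(j <- Y) _) *+ _]mulr_natr.
by ring.
Qed.

Lemma expDdiv r n w : q ^+ (r + n) / q ^+ w.+1 = q ^+ n * (q ^+ r / q ^+ w.+1).
Proof. by rewrite exprD; ring. Qed.

Lemma exp_divB r n w : (n <= w)%N ->
  q ^+ r / q ^+ (w - n).+1 = q ^+ n * (q ^+ r / q ^+ w.+1).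
Proof.
move=> nw; rewrite -[w in RHS](subnK nw) -addSn exprD.
by field; rewrite ?expf_neq0.
Qed.

Lemma rest_coef1_rec r n w y : (0 < r)%N ->
  rest_coef1 (r + n) w y + rest_coef1 r w (y + n)
  - (if (n < w)%N then rest_coef1 r (w - n) y else 0)
  - q ^+ n * rest_coef1 r w y = rest_coef1 r w n.
Proof.
move=> r0; rewrite /rest_coef1.
rewrite expDdiv exprD; have := @exp_divB r n w; move: (q ^+ r / q ^+ w.+1) => E eW.
case: (ltnP n w) => nw.
  rewrite (eW (ltnW nw)).
  have -> : (w <= y + n)%N = (w - n <= y)%N by lia.
  have -> : (w < r + n)%N = (w - n < r)%N by lia.
  by rewrite mulr0n; ring.
have -> : (w <= y + n)%N = true by lia.
have -> : (w < r + n)%N = true by lia.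
by rewrite mulr1n; ring.
Qed.

(** As in [full_coef_rec], with one more source: [P_n * Ft (w :: D)] also
    contains [Ft (w + n :: D)], so the remainder [w] receives the coefficient of
    [w - n]. *)
Lemma rest_coef_rec r n w Y : (0 < r)%N ->
  rest_coef (r + n) Y w + \sum_(Y' <- bumps n Y) rest_coef r Y' w
  - (if (n < w)%N then rest_coef r Y (w - n) else 0) - (q ^+ n - 1) * rest_coef r Y w
  = rest_coef r (n :: Y) w.
Proof.
move=> r0; case: Y => [|a Y].
  rewrite big_nil /rest_coef /= big_seq1 /rest_coef1 expDdiv mul1r.
  have := @exp_divB r n w; move: (q ^+ r / q ^+ w.+1) => E eW.
  case: (ltnP n w) => nw.
    rewrite (eW (ltnW nw)); have -> : (w < r + n)%N = (w - n < r)%N by lia.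
    by rewrite mulr0n; ring.
  have -> : (w < r + n)%N = true by lia.
  by rewrite mulr1n; ring.
set Z := a :: Y; have Zs : size Z = (size Y).+1 by [].
have cZ s v : rest_coef s Z v = (size Y)`!%:R * \sum_(y <- Z) rest_coef1 s v y by [].
have -> : \sum_(Y' <- bumps n Z) rest_coef r Y' w =
    (size Y)`!%:R * \sum_(Y' <- bumps n Z) \sum_(y <- Y') rest_coef1 r w y.
  rewrite mulr_sumr big_seq [RHS]big_seq; apply: eq_bigr => -[|b B] /bumpsP[_ //= [sB]].
  by rewrite sB.
have -> : rest_coef r (n :: Z) w = (size Z)`!%:R * (rest_coef1 r w n + \sum_(y <- Z) rest_coef1 r w y).
  by rewrite /rest_coef big_cons.
rewrite sum_sum_bumps !cZ Zs (factS (size Y)) natrM.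
have : \sum_(y <- Z) (rest_coef1 (r + n) w y + rest_coef1 r w (y + n)
  - (if (n < w)%N then rest_coef1 r (w - n) y else 0)
  - q ^+ n * rest_coef1 r w y) = \sum_(y <- Z) rest_coef1 r w n.
  by apply: eq_bigr => y _; apply: rest_coef1_rec.
rewrite !big_split /= !sumrN -mulr_sumr big_const_seq count_predT iter_addr_0 Zs.
have -> : (if (n < w)%N then (size Y)`!%:R * \sum_(y <- Z) rest_coef1 r (w - n) y else 0) =
   (size Y)`!%:R * \sum_(y <- Z) (if (n < w)%N then rest_coef1 r (w - n) y else 0).
  by case: ifP => // _; rewrite big1 ?mulr0.
rewrite -[(\sum_(y <- Z) _) *+ _]mulr_natr -[rest_coef1 r w n *+ _]mulr_natr.
move: (\sum_(y <- Z) (if _ then _ else _)) => S1.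
move: (\sum_(y <- Z) rest_coef1 r w y) (\sum_(y <- Z) rest_coef1 (r + n) w y) => S2 S3.
move: (\sum_(y <- Z) rest_coef1 r w (y + n)) => S4 e.
have -> : S4 = rest_coef1 r w n * (size Y).+1%:R + q ^+ n * S2 + S1 - S3 by rewrite -e; ring.
by ring.
Qed.

Definition expansion_term r Y D : Lambda :=
  full_coef r Y *: C (r + sumn Y) (M D) +
  \sum_(1 <= w < r + sumn Y) rest_coef r Y w *: C (r + sumn Y - w) (M (w :: D)).

Lemma rest_coef_eq0 r Y w : (0 < r)%N -> (r + sumn Y <= w)%N -> rest_coef r Y w = 0.
Proof.
move=> r0; case: Y => [|a Y] rYw /=.
  by rewrite [(w < r)%N](_ : _ = false) ?mul0r //; move: rYw => /=; lia.
rewrite big_seq big1 ?mulr0 // => y /leq_sumn /= yY; rewrite /rest_coef1.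
rewrite [(w < r)%N](_ : _ = false); last by move: rYw => /=; lia.
by rewrite mul0r subr0 [(w <= y)%N](_ : _ = false) ?mul0r //; move: rYw yY => /=; lia.
Qed.

Lemma shift_term r Y D n : (0 < r)%N ->
  \sum_(1 <= w < r + sumn Y) rest_coef r Y w *: C (r + sumn Y - w) (M ((w + n)%N :: D)) =
  \sum_(1 <= w < r + sumn Y + n)
    (if (n < w)%N then rest_coef r Y (w - n) else 0) *: C (r + sumn Y + n - w) (M (w :: D)).
Proof.
move=> r0; rewrite [RHS](big_cat_nat (n := n.+1)) //=; last by lia.
rewrite [X in _ = X + _]big_nat [X in _ = X + _]big1 ?add0r => [|w /andP[_]]; last first.
  by rewrite ltnS leqNgt => /negbTE ->; rewrite scale0r.
rewrite -[n.+1]add1n big_addn addnK !big_nat; apply: eq_bigr => w /andP[w0 wc].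
by rewrite addnK subnDr [(n < _)%N](_ : _ = true) //; lia.
Qed.

Lemma widen_term r Y D n : (0 < r)%N ->
  \sum_(1 <= w < r + sumn Y) rest_coef r Y w *: C (r + sumn Y - w + n) (M (w :: D)) =
  \sum_(1 <= w < r + sumn Y + n) rest_coef r Y w *: C (r + sumn Y + n - w) (M (w :: D)).
Proof.
move=> r0; rewrite [RHS](big_cat_nat (n := (r + sumn Y)%N)) //=; [|lia|lia].
rewrite [X in _ = _ + X]big_nat [X in _ = _ + X]big1 ?addr0 => [|w /andP[cw _]]; last first.
  by rewrite rest_coef_eq0 ?scale0r.
by rewrite !big_nat; apply: eq_bigr => w /andP[w0 wc]; rewrite addnBAC // ltnW.
Qed.

Lemma spsum_term r n Y D : (0 < r)%N -> (0 < n)%N -> positive D ->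
  spsum F n * expansion_term r Y D + \sum_(D' <- bumps n D) expansion_term r Y D' =
  expansion_term r Y (n :: D) - ((q ^+ n - 1) * full_coef r Y) *: C (r + sumn Y + n) (M D)
  - \sum_(1 <= w < r + sumn Y + n)
     ((if (n < w)%N then rest_coef r Y (w - n) else 0) + (q ^+ n - 1) * rest_coef r Y w)
       *: C (r + sumn Y + n - w) (M (w :: D)).
Proof.
move=> r0 n0 D0; have c0 : (0 < r + sumn Y)%N by rewrite addn_gt0 r0.
under [X in _ = _ - X]eq_bigr => w _ do rewrite scalerDl -scalerA.
rewrite [X in _ = _ - X]big_split /= -[X in _ = _ - (_ + X)]scaler_sumr -shift_term // -widen_term //.
rewrite /expansion_term mulrDr -scalerAr spsum_C // mulr_sumr.
have -> : \sum_(1 <= w < r + sumn Y) spsum F n * (rest_coef r Y w *: C (r + sumn Y - w) (M (w :: D))) =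
   \sum_(1 <= w < r + sumn Y) (rest_coef r Y w *: C (r + sumn Y - w) (M (w :: n :: D))
    - rest_coef r Y w *: C (r + sumn Y - w) (M ((w + n)%N :: D))
    - \sum_(B <- bumps n D) rest_coef r Y w *: C (r + sumn Y - w) (M (w :: B))
    - (q ^+ n - 1) *: (rest_coef r Y w *: C (r + sumn Y - w + n) (M (w :: D)))).
  rewrite !big_nat; apply: eq_bigr => w /andP[w0 wc].
  rewrite -scalerAr spsum_C ?subn_gt0 //; last exact: positive_cons.
  rewrite /= big_cons big_map (perm_aug_sym _ (_ : perm_eq (n :: w :: D) (w :: n :: D))); last first.
    by rewrite (perm_catCA [:: n] [:: w]).
  rewrite !scalerBr scalerDr opprD addrA scaler_sumr; congr (_ - _).
  by rewrite [LHS]scalerA [RHS]scalerA mulrC.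
(* Generalizing [Cop] keeps it folded in the linear rearrangement below. *)
move: Cop => C'.
rewrite !sumrB -scaler_sumr big_split /= exchange_big /= !scalerBr scaler_sumr.
rewrite scalerA [full_coef r Y * _]mulrC.
by ring.
Qed.

(** The induction step, for one split: the part [n] ends up either among the
    consumed parts or among the untouched ones. *)
Lemma expansion_step r n Y D : (0 < r)%N -> (0 < n)%N -> positive D ->
  spsum F n * expansion_term r Y D + expansion_term (r + n) Y D
  + (\sum_(Y' <- bumps n Y) expansion_term r Y' D + \sum_(D' <- bumps n D) expansion_term r Y D')
  = expansion_term r (n :: Y) D + expansion_term r Y (n :: D).
Proof.
move=> r0 n0 D0; rewrite [X in _ + X]addrC addrACA spsum_term //.
set c := (r + sumn Y + n)%N.
have -> : \sum_(Y' <- bumps n Y) expansion_term r Y' D =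
   (\sum_(Y' <- bumps n Y) full_coef r Y') *: C c (M D) +
   \sum_(1 <= w < c) (\sum_(Y' <- bumps n Y) rest_coef r Y' w) *: C (c - w) (M (w :: D)).
  rewrite scaler_suml; under [X in _ = _ + X]eq_bigr => w _ do rewrite scaler_suml.
  rewrite exchange_big -big_split /= big_seq [RHS]big_seq; apply: eq_bigr => B /bumpsP[sB _].
  by rewrite /expansion_term sB addnA.
rewrite /expansion_term [sumn (n :: Y)]/= [(r + n + sumn Y)%N]addnAC [(n + sumn Y)%N]addnC addnA -/c.
rewrite -full_coef_rec.
under [X in _ = _ + X + _]eq_bigr => w _ do rewrite -rest_coef_rec // !scalerBl scalerDl.
(* Generalizing [Cop] keeps it folded in the linear rearrangement below. *)
move: Cop => C'.
under [X in _ - _ - X]eq_bigr => w _ do rewrite scalerDl.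
by rewrite !sumrB !big_split /= scalerBl scalerDl; ring.
Qed.

(** Newton's identity, with [h_a] written as a multiple of [C_a 1] and the product
    [p_w C_(r-w) 1] turned into [C_(r-w) p_w].  The corrections, multiples of
    [q^(r-1) - q^(r-1-w)], turn the coefficient [r q^(r-1)] of [C_r 1] into the
    [q]-integer of [r]. *)
Lemma spsum_expansion r : (0 < r)%N ->
  spsum F r = qint r *: C r 1 +
    \sum_(1 <= w < r) (q ^+ r / q ^+ w.+1) *: C (r - w) (spsum F w).
Proof.
move=> r0.
have CE w : (0 < w < r)%N -> (q ^+ r / q ^+ w.+1) *: C (r - w) (spsum F w) =
    (-1) ^+ r *: (psum F w.-1 * hsum F (r - w)) +
    (q ^+ r.-1 - q ^+ (r.-1 - w)) *: C r 1.
  move=> /andP[w0 wr].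
  have [w' [a [wE ra]]] : exists w' a, w = w'.+1 /\ r = (w'.+1 + a.+1)%N.
    by exists w.-1, (r - w).-1; lia.
  have rw0 : (0 < r - w)%N by rewrite subn_gt0.
  have := Cop_spsum rw0 w0 (rpred1 _); rewrite mulr1 subnK ?(ltnW wr) // => /(canLR (subrK _)) <-.
  rewrite scalerDr scalerA; subst w r.
  have -> : (w'.+1 + a.+1 - w'.+1)%N = a.+1 by rewrite addKn.
  have -> : (w'.+1 + a.+1).-1 = (w'.+1 + a)%N by rewrite addnS.
  rewrite addKn; congr (_ + _ *: _).
    rewrite Cop1 /spsum -scalerAl -scalerAr !scalerA; congr (_ *: _) => /=.
    by rewrite (exprNn q^-1) exprVn !exprD !exprS; field; rewrite ?expf_neq0.
  by rewrite !exprD !exprS; field; rewrite ?expf_neq0.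
rewrite (eq_big_nat _ _ CE) big_split /= -scaler_sumr -scaler_suml.
have := hsum_newton F r; rewrite big_nat_recr //= subnn hsum0 mulr1 => /(canLR (addrK _)) <-.
case: r r0 {CE} => // m _; rewrite Cop1 /spsum /=.
have -> : \sum_(1 <= i < m.+1) (q ^+ m - q ^+ (m - i)) = m.+1%:R * q ^+ m - qint m.+1.
  rewrite sumrB sumr_const_nat subn1 /= /qint big_ord_recr /= big_add1 /= big_mkord.
  have -> : \sum_(i < m) q ^+ (m - i.+1) = \sum_(i < m) q ^+ i.
    rewrite (reindex_inj rev_ord_inj) /=; apply: eq_bigr => i _.
    by rewrite subnSK // subKn // ltnW.
  by rewrite -mulr_natl -natr1; ring.
set x := (- q^-1) ^+ m; have xq : x * q ^+ m = (-1) ^+ m.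
  by rewrite -exprMn mulNr mulVf.
rewrite exprS mulN1r scalerBr !scalerA.
rewrite scaleNr opprK [X in _ + X]addrAC !addrA -!scalerDl [X in X *: _ + _](_ : _ = 0).
  by rewrite scale0r add0r.
by rewrite -xq; ring.
Qed.

(** By induction on the size, not on [A], since the step uses the expansions for
    [bumps n A]. *)
Lemma aug_sym_expansion r A : (0 < r)%N -> positive A ->
  M (r :: A) = \sum_(YD <- splits A) expansion_term r YD.1 YD.2.
Proof.
elim: {A}(size A) {-2}A (erefl (size A)) r => [|k IHk] [|n A] // => [_|[sA]] r r0 A0.
  have Mw w : (0 < w)%N -> M [:: w] = spsum F w.
    by move=> w0; have := @spsum_aug_sym F w [::] w0 A0; rewrite aug_sym_nil mulr1 big_nil subr0.
  rewrite big_seq1 Mw // spsum_expansion // /expansion_term /= addn0 aug_sym_nil.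
  rewrite /full_coef big_seq1 mul1r; congr (_ + _); rewrite !big_nat; apply: eq_bigr => w /andP[w0 wr].
  by rewrite wr mul1r Mw.
have n0 : (0 < n)%N by rewrite A0 ?mem_head.
have A0' : positive A by move=> x xA; rewrite A0 // inE xA orbT.
rewrite (perm_aug_sym _ (_ : perm_eq (r :: n :: A) (n :: r :: A))); last first.
  by rewrite (perm_catCA [:: r] [:: n]).
have := spsum_aug_sym F n0 (positive_cons r0 A0') => /(canLR (subrK _)) <-.
rewrite /= big_cons big_map IHk // [M ((r + n)%N :: A)]IHk ?addn_gt0 ?r0 //.
have -> : \sum_(B <- bumps n A) M (r :: B) =
    \sum_(B <- bumps n A) \sum_(YD <- splits B) expansion_term r YD.1 YD.2.
  rewrite big_seq [RHS]big_seq; apply: eq_bigr => B BA.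
  by apply: IHk => //; [rewrite (bumpsP BA).2 | apply: bumps_positive BA].
rewrite sum_splits_bumps /= big_cat !big_map -[RHS]big_split /=.
transitivity (\sum_(YD <- splits A) (spsum F n * expansion_term r YD.1 YD.2 +
    expansion_term (r + n) YD.1 YD.2 + (\sum_(Y' <- bumps n YD.1) expansion_term r Y' YD.2 +
    \sum_(D' <- bumps n YD.2) expansion_term r YD.1 D'))).
  by rewrite [RHS]big_split [X in _ = X + _]big_split /= mulr_sumr addrA.
rewrite big_seq [RHS]big_seq; apply: eq_bigr => YD YDA; apply: expansion_step => //.
by move=> x xD; rewrite A0' // (perm_mem (splits_perm YDA)) mem_cat xD orbT.
Qed.

(** * Positivity *)

Definition eval_nat_poly (b : {poly nat}) : F := (map_poly (fun k => k%:R) b).[q].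
Definition nat_polynomial (c : F) : Prop := exists b, c = eval_nat_poly b.

Lemma eval_nat_polyD b b' : eval_nat_poly (b + b') = eval_nat_poly b + eval_nat_poly b'.
Proof.
rewrite /eval_nat_poly -hornerD; congr (_.[q]); apply/polyP => i.
by rewrite coefD !coef_map_id0 // coefD natrD.
Qed.

Lemma eval_nat_polyM b b' : eval_nat_poly (b * b') = eval_nat_poly b * eval_nat_poly b'.
Proof.
rewrite /eval_nat_poly -hornerM; congr (_.[q]); apply/polyP => i.
rewrite coefM !coef_map_id0 // coefM natr_sum; apply: eq_bigr => j _.
by rewrite !coef_map_id0 // natrM.
Qed.

Lemma nat_polynomialD c c' : nat_polynomial c -> nat_polynomial c' -> nat_polynomial (c + c').
Proof. by move=> [b ->] [b' ->]; exists (b + b'); rewrite eval_nat_polyD. Qed.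

Lemma nat_polynomialM c c' : nat_polynomial c -> nat_polynomial c' -> nat_polynomial (c * c').
Proof. by move=> [b ->] [b' ->]; exists (b * b'); rewrite eval_nat_polyM. Qed.

Lemma nat_polynomial_nat n : nat_polynomial n%:R.
Proof.
exists (n%:P); rewrite /eval_nat_poly [map_poly _ _](_ : _ = (n%:R)%:P) ?hornerC //.
by apply/polyP => i; rewrite coef_map_id0 // !coefC; case: eqP.
Qed.

Lemma nat_polynomialX n : nat_polynomial (q ^+ n).
Proof.
exists ('X^n); rewrite /eval_nat_poly [map_poly _ _](_ : _ = 'X^n) ?hornerXn //.
by apply/polyP => i; rewrite coef_map_id0 // !coefXn; case: eqP.
Qed.

Lemma nat_polynomial_sum (I : eqType) (s : seq I) (f : I -> F) :
  (forall i, i \in s -> nat_polynomial (f i)) -> nat_polynomial (\sum_(i <- s) f i).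
Proof.
move=> fN; rewrite big_seq; elim/big_ind: _ => //; first exact: (nat_polynomial_nat 0).
exact: nat_polynomialD.
Qed.

Lemma qint_nat n : nat_polynomial (qint n).
Proof. by apply: nat_polynomial_sum => i _; apply: nat_polynomialX. Qed.

Lemma full_coef_nat r Y : nat_polynomial (full_coef r Y).
Proof.
apply: nat_polynomialM; first exact: nat_polynomial_nat.
by apply: nat_polynomial_sum => y _; apply: qint_nat.
Qed.

Lemma expf_div m n : (n <= m)%N -> q ^+ m / q ^+ n = q ^+ (m - n).
Proof. by move=> nm; rewrite expfB_cond // (negbTE q_neq0). Qed.

(** For [w < r <= y] the two copies of [q^(r+y-w-1)] cancel; for [r <= w] the
    subtracted term is absent. *)
Lemma rest_coef1_nat r w y : (0 < r <= y)%N -> nat_polynomial (rest_coef1 r w y).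
Proof.
move=> /andP[r0 ry]; rewrite /rest_coef1; case: (ltnP w r) => wr.
  rewrite (leq_trans (ltnW wr) ry) !mul1r opprB addrC subrK mul1r expf_div //.
  exact: nat_polynomialX.
rewrite mul0r subr0; case: leqP => wy; last by rewrite !mul0r; apply: (nat_polynomial_nat 0).
rewrite mul1r mulrA -exprD expf_div; first exact: nat_polynomialX.
by lia.
Qed.

Lemma rest_coef_nat r Y w : (0 < r)%N -> (forall y, y \in Y -> (r <= y)%N) ->
  nat_polynomial (rest_coef r Y w).
Proof.
move=> r0; case: Y => [_|a Y rY].
  rewrite /rest_coef; case: ltnP => wr; last by rewrite mul0r; apply: (nat_polynomial_nat 0).
  by rewrite mul1r expf_div //; apply: nat_polynomialX.
apply: nat_polynomialM; first exact: nat_polynomial_nat.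
by apply: nat_polynomial_sum => y yY; apply: rest_coef1_nat; rewrite r0 rY.
Qed.

Definition C_positive n (f : Lambda) : Prop :=
  exists b : seq nat -> {poly nat},
    f = \sum_(alpha <- compositions n) eval_nat_poly (b alpha) *: foldr C 1 alpha.

Lemma C_positiveD n f g : C_positive n f -> C_positive n g -> C_positive n (f + g).
Proof.
move=> [b ->] [c ->]; exists (fun alpha => b alpha + c alpha).
by rewrite -big_split; apply: eq_bigr => alpha _; rewrite eval_nat_polyD scalerDl.
Qed.

Lemma C_positiveZ n a f : nat_polynomial a -> C_positive n f -> C_positive n (a *: f).
Proof.
move=> [c ->] [b ->]; exists (fun alpha => c * b alpha).
by rewrite scaler_sumr; apply: eq_bigr => alpha _; rewrite eval_nat_polyM scalerA.
Qed.

Lemma C_positive0 n : C_positive n 0.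
Proof.
exists (fun=> 0); rewrite big1 // => alpha _.
by rewrite /eval_nat_poly map_poly0 horner0 scale0r.
Qed.

Lemma C_positive_sum n (I : eqType) (s : seq I) (f : I -> Lambda) :
  (forall i, i \in s -> C_positive n (f i)) -> C_positive n (\sum_(i <- s) f i).
Proof.
move=> fN; rewrite big_seq; elim/big_ind: _ => //; first exact: C_positive0.
exact: C_positiveD.
Qed.

Lemma C_positive_composition alpha : 0%N \notin alpha -> C_positive (sumn alpha) (foldr C 1 alpha).
Proof.
move=> alpha0; exists (fun beta => if beta == alpha then 1 else 0).
rewrite (bigD1_seq alpha) ?compositions_uniq ?mem_compositions ?alpha0 ?eqxx //=.
rewrite big1 => [|beta /negbTE ->]; last first.
  by rewrite /eval_nat_poly map_poly0 horner0 scale0r.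
rewrite addr0 [eval_nat_poly 1](_ : _ = 1) ?scale1r // /eval_nat_poly.
rewrite [map_poly _ _](_ : _ = 1) ?hornerE //.
by apply/polyP => i; rewrite coef_map_id0 // !coef1; case: eqP.
Qed.

Lemma foldrC_in alpha : foldr C 1 alpha \in G.
Proof. by elim: alpha => [|a alpha IH] /=; [rewrite rpred1 | apply: Cop_in]. Qed.

Lemma C_positive_C n a f : (0 < a)%N -> C_positive n f -> C_positive (a + n) (C a f).
Proof.
move=> a0 [b ->]; rewrite Cop_sum; last first.
  by move=> alpha _; rewrite rpredZ // foldrC_in.
apply: C_positive_sum => alpha; rewrite mem_compositions => /andP[alpha0 /eqP <-].
rewrite CopZ ?foldrC_in //; apply: C_positiveZ; first by exists (b alpha).
by apply: (@C_positive_composition (a :: alpha)); rewrite inE negb_or alpha0 andbT eq_sym -lt0n.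
Qed.

(** The expansion is taken at a smallest part, so that [rest_coef_nat] applies;
    the operators [C] in it act on functions of smaller degree. *)
Lemma aug_sym_positive A : positive A -> C_positive (sumn A) (M A).
Proof.
elim: {A}(sumn A).+1 {-2}A (ltnSn (sumn A)) => // k IHk A Ak A0.
case E: (sort leq A) => [|r B].
  have -> : A = [::] by apply/nilP; rewrite /nilp -(size_sort leq) E.
  by rewrite aug_sym_nil; apply: (@C_positive_composition [::]).
have pA : perm_eq A (r :: B) by rewrite -E perm_sym perm_sort.
have rB y : y \in B -> (r <= y)%N.
  have := sort_sorted leq_total A; rewrite E /= => /(order_path_min leq_trans) /allP.
  exact.
have A0' x : x \in r :: B -> (0 < x)%N by rewrite -(perm_mem pA); apply: A0.
have r0 : (0 < r)%N by rewrite A0' ?mem_head.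
have B0 : positive B by move=> x xB; rewrite A0' // inE xB orbT.
rewrite (perm_aug_sym _ pA) aug_sym_expansion // (perm_sumn pA) /=.
apply: C_positive_sum => -[Y D] /splits_perm /= pB.
have sB : sumn B = (sumn Y + sumn D)%N by rewrite (perm_sumn pB) sumn_cat.
have rY y : y \in Y -> (r <= y)%N by move=> yY; rewrite rB // (perm_mem pB) mem_cat yY.
have D0 : positive D by move=> x xD; rewrite B0 // (perm_mem pB) mem_cat xD orbT.
have sA : sumn A = (r + sumn B)%N by rewrite (perm_sumn pA).
apply: C_positiveD.
  apply: C_positiveZ; first exact: full_coef_nat.
  rewrite sB addnA; apply: C_positive_C; first by rewrite addn_gt0 r0.
  by apply: IHk => //; lia.
apply: C_positive_sum => w; rewrite mem_index_iota => /andP[w0 wc].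
apply: C_positiveZ; first exact: rest_coef_nat.
rewrite sB (_ : (r + _)%N = (r + sumn Y - w) + sumn (w :: D))%N; last by rewrite /=; lia.
apply: C_positive_C; first by rewrite subn_gt0.
by apply: IHk; [rewrite /=; lia | apply: positive_cons].
Qed.
End Operators.

(** * The theorem *)

Lemma natr_Kqt_neq0 n : n.+1%:R != 0 :> Kqt.
Proof.
rewrite -[_%:R](rmorph_nat (@tofrac {mpoly rat[2]})) tofrac_eq0.
by rewrite -mpolyC_nat mpolyC_eq0 Num.Theory.pnatr_eq0.
Qed.

Lemma q_neq0 : q != 0.
Proof. by rewrite tofrac_eq0 -msize_poly_eq0 msizeX. Qed.

Lemma eval_psum_plethysm N (P : {mpoly Kqt[N]}) :
  is_plethysm q (eval_psum P) (plethysm (eval_psum P)).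
Proof.
rewrite /plethysm /psum_expansion; case: pselect => [e|[]]; last first.
  by exists (existT _ N P).
case: (cid e) => -[M R] /= <-; exact: (is_plethysm_eval q R).
Qed.

Lemma plethysm_is_plethysm (f : Lambda) :
  f \in psum_subalg (F := Kqt) -> is_plethysm q f (plethysm f).
Proof. by move=> /asboolP[N [P <-]]; apply: eval_psum_plethysm. Qed.

Lemma sumn_lm_shape (A : labelled_multiset) : sumn (lm_shape A) = lm_sum A.
Proof.
rewrite /lm_shape (perm_sumn (permEl (perm_sort _ _))) sumnE big_map big_enum.
by [].
Qed.

(** The factor for [i = 0] in [mult_fact] is [0`!], because the values are
    positive. *)
Lemma Ftilde_aug_sym (A : labelled_multiset) : Ftilde A = aug_sym Kqt (lm_shape A).
Proof.
rewrite /Ftilde /F_ scalerA mulrC /aug_sym sumn_lm_shape size_sort size_map -cardE.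
congr (_ * _%:R *: _); rewrite /mult_fact sumn_lm_shape [RHS]big_nat_recl //.
have count_lm i : count_mem i (lm_shape A) = lm_mult A i.
  rewrite (permP (permEl (perm_sort _ _))) count_map /lm_mult cardsE cardE size_filter enumT.
  by apply: eq_count.
rewrite [in RHS](count_memPn _) ?mul1n; last first.
  by rewrite mem_sort; apply/mapP => -[x _ x0]; have := value_gt0 x; rewrite -x0.
by rewrite big_add1; apply: eq_bigr => i _; rewrite count_lm.
Qed.

Theorem theorem4p2 (A : labelled_multiset) :
  exists b : seq nat -> {poly nat},
    Ftilde A =
    \sum_(alpha <- compositions (lm_sum A)) eval_q (b alpha) *: C_comp alpha 1.
Proof.
rewrite Ftilde_aug_sym -sumn_lm_shape.
apply: (aug_sym_positive natr_Kqt_neq0 q_neq0 plethysm_is_plethysm) => x.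
by rewrite mem_sort => /mapP[y _ ->]; apply: value_gt0.
Qed.
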